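(* Let $\Lambda$ be the Lyapunov function and let $\mathbb X=\{x(\frac pq):\frac pq\in[0,\frac12]\cap\mathbb Q\}$ be the set of Markov-Hurwitz numbers. The restriction $\Lambda_{\mathbb X}$ of $\Lambda$ to $\mathbb X$ is monotonically increasing from $$\Lambda(x_2)=\tfrac12\ln(1+\sqrt2)\quad\text{to}\quad \Lambda(x_1)=\ln\left(\frac{1+\sqrt5}{2}\right),$$ where $x_2=x(\frac12)=\sqrt2-1$ and $x_1=x(\frac01)=\frac{\sqrt5-1}{2}$. Moreover, in the Farey parametrization, $\Lambda(x(\frac pq))$ is convex as a function of $\frac pq\in[0,\frac12]\cap\mathbb Q$.
   Context: Continued fractions: $[a_1,a_2,\dots]:=\cfrac{1}{a_1+\cfrac{1}{a_2+\dots}}$, with positive integers $a_i$; an overline denotes a period. Markov-Hurwitz numbers. To each rational $r\in[0,\frac12]$ assign a finite word $P(r)$ in the letters $1,2$: $P(\frac01)=(1,1)$, $P(\frac12)=(2,2)$, and if $\frac pq<\frac{p'}{q'}$ are fractions in $[0,\frac12]$ with $p'q-pq'=1$, then $P\left(\frac{p+p'}{q+q'}\right)=P(\frac{p'}{q'})P(\frac pq)$ (concatenation, the word of the larger fraction first). This defines $P$ on all rationals in $[0,\frac12]$. Put $x(r)=[\overline{P(r)}]$. For example $x(\frac01)=[\overline{1}]=\frac{\sqrt5-1}2$, $x(\frac12)=[\overline 2]=\sqrt2-1$, $x(\frac13)=[\overline{2,2,1,1}]=\frac{\sqrt{221}-9}{14}$. The number $x(r)$ is also written $x_m$, where $m=m(r)$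 is the Markov number at the corresponding place of the Markov tree ($m(\frac01)=1$, $m(\frac12)=2$, $m(\frac13)=5$, ...). The largest element of $\mathbb X$ is $x_1$ and the smallest is $x_2$. Lyapunov function. Let $L=\begin{pmatrix}1&1\\0&1\end{pmatrix}$, $R=\begin{pmatrix}1&0\\1&1\end{pmatrix}$. For real $x\ge 0$ define matrices $A_n(x)=\begin{pmatrix}a_n&b_n\\c_n&d_n\end{pmatrix}$ by $A_0(x)=I$ and $A_{n+1}(x)=A_n(x)R$ if $x<\frac{a_n+b_n}{c_n+d_n}$, $A_{n+1}(x)=A_n(x)L$ if $x>\frac{a_n+b_n}{c_n+d_n}$ (equality never occurs for irrational $x$; all elements of $\mathbb X$ are irrational). Let $w_n(x)$ be the largest entry of $A_n(x)$ (for $x\in[0,1)$, $n\ge1$, it is $\max(c_n,d_n)$). Then $\Lambda(x)=\limsup_{n\to\infty}\frac{\ln w_n(x)}{n}$. *)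

(* Defs.v *)
From HB Require Import structures.
From mathcomp Require Import all_boot all_order all_algebra.
From mathcomp Require Import all_classical all_reals all_analysis.
From mathcomp Require Import zify ring lra.

Set Implicit Arguments.
Unset Strict Implicit.
Unset Printing Implicit Defensive.

Import Order.TTheory GRing.Theory Num.Theory.
Import numFieldNormedType.Exports.

Local Open Scope classical_set_scope.
Local Open Scope ring_scope.

(* Descent in the Farey tree from the Farey neighbours p/q < p'/q', carrying
   the words u and v, to the target a/b in [p/q, p'/q'].  The first argument
   is fuel: a/b strictly between p/q and p'/q' forces q + q' <= b, so b steps
   always suffice. *)
Fixpoint farey_descent (n p q : nat) (u : seq nat) (p' q' : nat) (v : seq nat)
    (a b : nat) : seq nat :=
  if (a * q == p * b)%N then u
  else if (a * q' == p' * b)%N then v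
  else if n is n'.+1 then
    if (a * (q + q') <= (p + p') * b)%N
    then farey_descent n' p q u (p + p') (q + q') (v ++ u) a b
    else farey_descent n' (p + p') (q + q') (v ++ u) p' q' v a b
  else [::].

(* Meaningful for r in [0, 1/2]; it is the unique function satisfying
   [farey_word0], [farey_word_half] and [farey_word_mediant] below. *)
Definition farey_word (r : rat) : seq nat :=
  farey_descent `|denq r| 0 1 [:: 1; 1]%N 1 2 [:: 2; 2]%N `|numq r| `|denq r|.

Section FareyWordSpec.
Local Open Scope nat_scope.

Lemma farey_descent_left n p q u p' q' v a b :
  0 < q -> p' * q = p * q' + 1 -> a * (q + q') <= (p + p') * b -> 0 < b ->
  farey_descent n.+1 p q u p' q' v a b
  = farey_descent n p q u (p + p') (q + q') (v ++ u) a b.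
Proof.
move=> q0 h le b0 /=.
have [e|ne] := eqVneq (a * q) (p * b); first by case: n => [|n] /=; rewrite e eqxx.
case: eqP => [e|_]; last by rewrite le.
exfalso; have : p' * b * q <= p * b * q' by nia.
nia.
Qed.

Lemma farey_descent_right n p q u p' q' v a b :
  0 < q' -> p' * q = p * q' + 1 -> (p + p') * b <= a * (q + q') -> 0 < b ->
  farey_descent n.+1 p q u p' q' v a b
  = farey_descent n (p + p') (q + q') (v ++ u) p' q' v a b.
Proof.
move=> q0 h le b0.
have ne : (a * q == p * b) = false.
  apply/negP => /eqP e; have : p' * b * q <= p * b * q' by nia.
  by nia.
have [e|ne'] := eqVneq (a * (q + q')) ((p + p') * b).
  have ne' : (a * q' == p' * b) = false.
    by apply/negP => /eqP e'; move/eqP: ne; apply; lia.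
  rewrite farey_descent_left ?e //; last by case: (q) h => //; lia.
  by case: n => [|n] /=; rewrite e eqxx ne.
rewrite /= ne; case: eqP => [e|_].
  case: n => [|n] /=; rewrite e eqxx; case: eqP => //; lia.
by rewrite leqNgt ltn_neqAle eq_sym ne' le.
Qed.

Lemma farey_between p q p' q' a b : p' * q = p * q' + 1 ->
  p * b < a * q -> a * q' < p' * b -> q + q' <= b.
Proof.
move=> h h1 h2.
have h3 : q' * (p * b).+1 <= q' * (a * q) by rewrite leq_mul2l h1 orbT.
have h4 : q * (a * q').+1 <= q * (p' * b) by rewrite leq_mul2l h2 orbT.
have : q * (p' * b) = q' * (p * b) + b by rewrite mulnCA; nia.
have : q * (a * q') = q' * (a * q) by lia.
lia.
Qed.

Lemma farey_descent_fuel n m p q u p' q' v a b : p' * q = p * q' + 1 ->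
  p * b <= a * q -> a * q' <= p' * b -> 0 < q -> 0 < q' -> 0 < b ->
  b < n + q + q' -> b < m + q + q' ->
  farey_descent n p q u p' q' v a b = farey_descent m p q u p' q' v a b.
Proof.
elim: n m p q u p' q' v => [|n IH] m p q u p' q' v h h1 h2 q0 q'0 b0 hn hm.
  have [e|ne] := eqVneq (a * q) (p * b).
    by case: m hm => [|m] _ //=; rewrite e eqxx.
  have [e|ne'] := eqVneq (a * q') (p' * b).
    by case: m hm => [|m] _ //=; rewrite (negbTE ne) e eqxx.
  have := @farey_between p q p' q' a b h; lia.
have [e|ne] := eqVneq (a * q) (p * b).
  by case: m hm => [|m] _ /=; rewrite e eqxx.
have [e|ne'] := eqVneq (a * q') (p' * b).
  by case: m hm => [|m] _ /=; rewrite (negbTE ne) e eqxx.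
case: m hm => [|m] hm.
  have := @farey_between p q p' q' a b h; lia.
rewrite /= (negbTE ne) (negbTE ne').
by case: leqP => le; apply: IH; lia.
Qed.

Lemma farey_left_den p q p' q' a b : p' * q = p * q' + 1 ->
  p * b <= a * q -> a * q' < p' * b -> q <= b.
Proof.
move=> h h1 h2.
have h3 : q' * (p * b) <= q' * (a * q) by rewrite leq_mul2l h1 orbT.
have h4 : q * (a * q').+1 <= q * (p' * b) by rewrite leq_mul2l h2 orbT.
have : q * (p' * b) = q' * (p * b) + b by rewrite mulnCA; nia.
have : q * (a * q') = q' * (a * q) by lia.
lia.
Qed.

Lemma farey_right_den p q p' q' a b : p' * q = p * q' + 1 ->
  p * b < a * q -> a * q' <= p' * b -> q' <= b.
Proof.
move=> h h1 h2.
have h3 : q' * (p * b).+1 <= q' * (a * q) by rewrite leq_mul2l h1 orbT.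
have h4 : q * (a * q') <= q * (p' * b) by rewrite leq_mul2l h2 orbT.
have : q * (p' * b) = q' * (p * b) + b by rewrite mulnCA; nia.
have : q * (a * q') = q' * (a * q) by lia.
lia.
Qed.

Lemma farey_coprime p q p' q' : p' * q = p * q' + 1 ->
  coprime p q /\ coprime p' q'.
Proof.
move=> h; split; rewrite /coprime -dvdn1.
  rewrite -(dvdn_addr 1 (dvdn_mulr q' (dvdn_gcdl p q))) -h.
  exact/dvdn_mull/dvdn_gcdr.
rewrite -(dvdn_addr 1 (dvdn_mull p (dvdn_gcdr p' q'))) -h.
exact/dvdn_mulr/dvdn_gcdl.
Qed.

Lemma eq_coprime_fraction a b p q : 0 < b -> coprime a b -> coprime p q ->
  a * q = p * b -> a = p /\ b = q.
Proof.
move=> b0 cab cpq e.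
have eb : b = q.
  apply/eqP; rewrite eqn_dvd -(Gauss_dvdr (m := b) (n := a) q); last first.
    by rewrite coprime_sym.
  rewrite e dvdn_mull //= -(Gauss_dvdr (m := q) (n := p) b); last first.
    by rewrite coprime_sym.
  by rewrite -e dvdn_mull.
by split=> //; apply/eqP; rewrite -(eqn_pmul2r b0) -e eb.
Qed.

Lemma farey_descent_mediant n p q u p' q' v a b a' b' :
  p' * q = p * q' + 1 -> a' * b = a * b' + 1 ->
  p * b <= a * q -> a' * q' <= p' * b' -> 0 < q -> 0 < q' -> 0 < b -> 0 < b' ->
  b + b' < n + q + q' ->
  farey_descent n p q u p' q' v (a + a') (b + b')
  = farey_descent n p q u p' q' v a' b' ++ farey_descent n p q u p' q' v a b.
Proof.
elim: n p q u p' q' v => [|n IH] p q u p' q' v h h' h1 h2 q0 q'0 b0 b'0 hn.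
  have : q <= b.
    apply: (farey_left_den h h1).
    rewrite -(ltn_pmul2r b'0); have : a * b' * q' < a' * b * q' by nia.
    nia.
  have : q' <= b'.
    apply: (farey_right_den h _ h2).
    rewrite -(ltn_pmul2r b0); have : a * b' * q < a' * b * q by nia.
    nia.
  lia.
have [/andP[/eqP e /eqP e']|ne] :=
    boolP ((a * q == p * b) && (a' * q' == p' * b')).
  have [cpq cpq'] := farey_coprime h; have [cab cab'] := farey_coprime h'.
  have [ea eb] := eq_coprime_fraction b0 cab cpq e.
  have [ea' eb'] := eq_coprime_fraction b'0 cab' cpq' e'.
  subst a b a' b'.
  rewrite farey_descent_left //; last by rewrite addn_gt0 q0.
  have -> : farey_descent n.+1 p q u p' q' v p q = u by rewrite /= eqxx.
  have -> : farey_descent n.+1 p q u p' q' v p' q' = v.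
    by rewrite /= eqxx; case: eqP => //; lia.
  by case: (n) => [|k] /=; rewrite eqxx; case: eqP => //; lia.
have [le|lt] := leqP (a' * (q + q')) ((p + p') * b').
  rewrite !farey_descent_left //; try nia.
  by apply: IH; lia.
have [le|lt'] := leqP ((p + p') * b) (a * (q + q')).
  rewrite !farey_descent_right //; try nia.
  by apply: IH; lia.
exfalso.
have le_m : b + b' <= q + q' by apply: (farey_between (a := p + p') h'); lia.
have [e|ne1] := eqVneq (a * q) (p * b).
  have ne2 : a' * q' < p' * b' by rewrite ltn_neqAle h2 andbT; case: eqP ne => //; rewrite e eqxx.
  have : q + q' <= b'.
    apply: (farey_between h _ ne2).
    rewrite -(ltn_pmul2r b0); have : a * b' * q < a' * b * q by nia.
    nia.
  lia.
have lt1 : p * b < a * q by rewrite ltn_neqAle h1 eq_sym ne1.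
have : q + q' <= b.
  apply: (farey_between h lt1).
  rewrite -(ltn_pmul2r b'0); have : a * b' * q' < a' * b * q' by nia.
  nia.
lia.
Qed.

Lemma farey_wordE a b : 0 < b -> coprime a b ->
  farey_word (a%:R / b%:R)
  = farey_descent b 0 1 [:: 1; 1] 1 2 [:: 2; 2] a b.
Proof.
move=> b0 cab; rewrite /farey_word.
have -> : (a%:R / b%:R : rat)%R = ((a%:Z)%:~R / (b%:Z)%:~R)%R by [].
rewrite coprimeq_num // coprimeq_den //.
have -> : (b%:Z == 0)%R = false by lia.
by rewrite gtr0_sg ?ltz_nat // mul1r.
Qed.

Lemma farey_word0 : farey_word 0 = [:: 1; 1].
Proof. by []. Qed.

Lemma farey_word_half : farey_word (1 / 2%:R)%R = [:: 2; 2].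
Proof. by rewrite (@farey_wordE 1 2). Qed.

Lemma farey_word_mediant p q p' q' : p' * q = p * q' + 1 -> 2 * p' <= q' ->
  farey_word ((p + p')%:R / (q + q')%:R)
  = farey_word (p'%:R / q'%:R) ++ farey_word (p%:R / q%:R).
Proof.
move=> h le.
have q0 : 0 < q by case: q h => //; lia.
have q'0 : 0 < q' by case: p' h le => [|p'] //; lia.
have [cpq cpq'] := farey_coprime h.
have h'' : (p + p') * q = p * (q + q') + 1 by lia.
have [_ cm] := farey_coprime h''.
have lt : 2 * p < q.
  have : 2 * p' * q <= q' * q by rewrite leq_mul2r le orbT.
  by rewrite -(ltn_pmul2r q'0); lia.
rewrite !farey_wordE ?addn_gt0 ?q0 //.
rewrite (farey_descent_mediant (n := q + q')) //; try lia.
by congr (_ ++ _); apply: farey_descent_fuel; lia.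
Qed.

End FareyWordSpec.

Section MarkovHurwitz.
Variable R : realType.
Implicit Types (x : R) (r : rat).

(* 1/(a_1 + 1/(a_2 + ... + 1/a_n)); the empty fraction is 0. *)
Definition cfrac_seq (s : seq nat) : R :=
  foldr (fun a y => (a%:R + y)^-1) 0 s.

(* The infinite fraction [a 0, a 1, a 2, ...]. *)
Definition cfrac (a : nat -> nat) : R := limn (fun n => cfrac_seq (mkseq a n)).

Definition cfrac_periodic (s : seq nat) : R :=
  cfrac (fun i => nth 0%N s (i %% size s)).

Definition markov_hurwitz r : R := cfrac_periodic (farey_word r).

Definition farey_domain : set rat := [set r | 0 <= r <= 1 / 2].

Definition markov_hurwitz_set : set R := markov_hurwitz @` farey_domain.

Definition Lmx : 'M[nat]_2 := \matrix_(i, j) ((i <= j)%N : nat).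
Definition Rmx : 'M[nat]_2 := \matrix_(i, j) ((j <= i)%N : nat).

(* Ties, which occur only for rational x, are sent to Lmx. *)
Fixpoint euclid_mx x (n : nat) : 'M[nat]_2 :=
  if n is n'.+1 then
    let A := euclid_mx x n' in
    A *m (if x < (A 0 0 + A 0 1)%:R / (A 1 0 + A 1 1)%:R then Rmx else Lmx)
  else 1%:M.

Definition max_entry (A : 'M[nat]_2) : nat := (\max_i \max_j A i j)%N.

(* The sequence lies in [0, ln 2], so the real-valued limsup is the true one.
   Its value at n = 0 is irrelevant. *)
Definition Lyapunov x : R :=
  limn_sup (fun n => ln (max_entry (euclid_mx x n))%:R / n%:R).

End MarkovHurwitz.

Arguments markov_hurwitz_set : clear implicits.

(* Main.v *)
(** Let W(r) be the product of the matrices [[0,1],[1,a_i]] over the word P(r),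
   r = p/q.  It is in SL_2 with positive entries, the letters of P(r) sum to 2q,
   and the algorithm defining Lambda reads W(r) periodically on x(r), the positive
   fixed point of W(r).  Hence Lambda(x(r)) = ln(lam(r)) / (2q), with lam(r) the
   larger eigenvalue.

   Convexity at an interior c: conjugate all words to the eigenbasis of W(c).
   Markov's equation for the traces of Farey neighbours implies that the
   off-diagonal entries of the matrix X(z) of z have a common sign on either side
   of c, so along the Farey tree X(z)_00 is supermultiplicative on either side;
   replacing X by X^-1 passes from one side to the other.  This gives a linear
   form phi in (p, q) with phi(c) = ln(lam(c)) and phi(z) <= ln(X(z)_00), and
   X_00 <= lam because X_00 X_11 >= 1.  So phi / (2q) is a supporting line at c.
   The sign of X(z)_10 is that of x(c) - x(z), which makes x antitone.

   The same argument in the eigenbasis of W(1/2) yields Lambda(x(r)) >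
   Lambda(x(1/2)) for r < 1/2, and convexity makes Lambda(x(r)) strictly
   decreasing in r. *)

Require Import Defs.
From mathcomp Require Import all_boot all_order all_algebra.
From mathcomp Require Import all_classical all_reals all_analysis.
From mathcomp Require Import zify ring lra.

Set Implicit Arguments.
Unset Strict Implicit.
Unset Printing Implicit Defensive.

Import Order.TTheory GRing.Theory Num.Theory.
Import numFieldNormedType.Exports.

Local Open Scope classical_set_scope.
Local Open Scope ring_scope.

(** * Continued fractions and the Euclidean algorithm *)

Definition mx22 (K : Type) (a b c d : K) : 'M[K]_2 :=
  \matrix_(i, j) if i == 0 then (if j == 0 then a else b)
                 else (if j == 0 then c else d).

Lemma ord2P (P : 'I_2 -> Prop) : P 0 -> P 1 -> forall i, P i.
Proof.
move=> P0 P1 [[|[|//]] h].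
- by rewrite (_ : Ordinal h = 0) //; apply: val_inj.
- by rewrite (_ : Ordinal h = 1) //; apply: val_inj.
Qed.

Lemma mulmx22E (K : pzSemiRingType) (A B : 'M[K]_2) i j :
  (A *m B) i j = A i 0 * B 0 j + A i 1 * B 1 j.
Proof.
rewrite mxE !big_ord_recl big_ord0 addr0.
by congr (_ * _ + A i _ * B _ j); apply: val_inj.
Qed.

Section Mx22.
Variable K : comNzRingType.
Implicit Types A B : 'M[K]_2.

Lemma mxtrace22 A : \tr A = A 0 0 + A 1 1.
Proof.
rewrite /mxtrace !big_ord_recl big_ord0 addr0.
by congr (_ + A _ _); apply: val_inj.
Qed.

Lemma det22 A : \det A = A 0 0 * A 1 1 - A 0 1 * A 1 0.
Proof.
rewrite (expand_det_row _ 0) !big_ord_recl big_ord0 addr0 /cofactor !det_mx11 !mxE /=.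
rewrite !(addn0, add0n) expr0 expr1 mul1r mulN1r mulrN.
by congr (A _ _ * A _ _ - A _ _ * A _ _); apply: val_inj.
Qed.

End Mx22.

Lemma cvg_of_norm_le (R : realType) (u v : nat -> R) (l : R) :
  (forall n, `|u n - l| <= v n) -> v @ \oo --> (0 : R) -> u @ \oo --> l.
Proof.
move=> h cv; apply/subr_cvg0.
apply: (squeeze_cvgr (f := fun n => - v n) (h := v)) => //.
  by apply: nearW => n; have := h n; rewrite ler_norml.
by rewrite -oppr0; apply: cvgN.
Qed.

Section ContinuedFractions.
Variable R : realType.
Implicit Types (s t : seq nat) (x y z : R).

Definition cfrac_tail s y : R := foldr (fun a z => (a%:R + z)^-1) y s.

Lemma cfrac_tail_cat s t y :
  cfrac_tail (s ++ t) y = cfrac_tail s (cfrac_tail t y).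
Proof. by rewrite /cfrac_tail foldr_cat. Qed.

Definition cf_digits s := all (fun a => 0 < a)%N s.

Lemma digit_ge1 (a : nat) : (0 < a)%N -> 1 <= a%:R :> R.
Proof. by move=> a0; rewrite ler1n. Qed.

Lemma cfrac_tail_ge0 s y : 0 <= y -> 0 <= cfrac_tail s y.
Proof. by move=> y0; elim: s => //= a s IH; rewrite invr_ge0 addr_ge0. Qed.

(* Two steps t |-> 1/(a + 1/(b + t)) contract by 1/(a(b + t) + 1)^2 <= 1/4. *)
Lemma cfrac_tail_contract s y z : cf_digits s -> 0 <= y -> 0 <= z ->
  `|cfrac_tail s y - cfrac_tail s z| <= 2 * (1 / 2) ^+ size s * `|y - z|.
Proof.
move=> + y0 z0.
have [n] := ubnP (size s); elim: n s => // n IH [|a [|b s]] /=.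
- by move=> _ _; rewrite expr0 mulr1 ler_peMl // ler1n.
- move=> _ /andP[/digit_ge1 a1 _]; rewrite expr1.
  have -> : 2 * (1 / 2) = 1 :> R by lra.
  rewrite mul1r.
  have -> : (a%:R + y)^-1 - (a%:R + z)^-1
    = (a%:R + y)^-1 * (a%:R + z)^-1 * (z - y).
    by field; apply/andP; split; lra.
  rewrite normrM distrC ler_piMl // ger0_norm ?mulr_ge0 ?invr_ge0; try lra.
  by rewrite mulr_ile1 ?invr_ge0 ?invf_le1; lra.
move=> sn /and3P[/digit_ge1 a1 /digit_ge1 b1 ds].
have := IH s _ ds; rewrite -ltnS (leq_trans _ sn) // => /(_ isT).
have := cfrac_tail_ge0 s y0; have := cfrac_tail_ge0 s z0.
move: (cfrac_tail s y) (cfrac_tail s z) => u v v0 u0 h.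
have -> : (a%:R + (b%:R + u)^-1)^-1 - (a%:R + (b%:R + v)^-1)^-1
  = (a%:R * (b%:R + u) + 1)^-1 * (a%:R * (b%:R + v) + 1)^-1 * (u - v).
  field.
  by apply/and4P; split; apply/lt0r_neq0; nra.
rewrite normrM exprS exprS.
have -> : 2 * (1 / 2 * (1 / 2 * (1 / 2) ^+ size s)) * `|y - z|
  = 2^-1 * 2^-1 * (2 * (1 / 2) ^+ size s * `|y - z|) by field.
have i w : 0 <= w -> 0 <= (a%:R * (b%:R + w) + 1)^-1 <= (2 : R)^-1.
  move=> w0; have c2 : 2 <= a%:R * (b%:R + w) + 1 by nra.
  by apply/andP; split; [rewrite invr_ge0 | rewrite lef_pV2 ?posrE]; lra.
have [/andP[iu0 iu] /andP[iv0 iv]] := (i u u0, i v v0).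
by apply: ler_pM => //; rewrite ger0_norm ?mulr_ge0 // ler_pM.
Qed.

(** After any number of digits the remainder is the unread rest of the period applied to [x]. When
    the period is used up, [sx] starts a new one. *)
Lemma cfrac_tail_stream s x n : s != [::] -> cfrac_tail s x = x ->
  let a i := nth 0%N s (i %% size s) in
  x = cfrac_tail (mkseq a n) (cfrac_tail (drop (n %% size s) s) x).
Proof.
move=> s0 sx a.
have ss : (0 < size s)%N by case: (s) s0.
elim: n => [|n IH]; first by rewrite mod0n drop0 sx.
rewrite {1}IH /mkseq -addn1 iotaD map_cat cfrac_tail_cat /= add0n.
have lt : (n %% size s < size s)%N by rewrite ltn_mod.
rewrite (drop_nth 0%N lt) /= -/(a n); congr (cfrac_tail _ (_ + _)^-1).
rewrite -modnDml; move: lt; rewrite leq_eqVlt => /orP[/eqP e|lt].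
  by rewrite addn1 e modnn drop0 drop_size /= sx.
by rewrite addn1 (modn_small lt).
Qed.

(** The convergent and [x] are the images of 0 and of a tail bounded by [x + 1] under the same [n]
    digits, so the contraction bounds their distance geometrically. *)
Lemma cfrac_periodicE s x : s != [::] -> cf_digits s -> 0 <= x ->
  cfrac_tail s x = x -> cfrac_periodic R s = x.
Proof.
move=> s0 ds x0 sx; rewrite /cfrac_periodic /cfrac.
pose a i := nth 0%N s (i %% size s); rewrite -/a; apply: cvg_lim => //.
have da n : cf_digits (mkseq a n).
  apply/allP => _ /mapP[i _ ->]; apply: (allP ds).
  by rewrite mem_nth // ltn_mod; case: (s) s0.
have bnd n : `|x - cfrac_seq R (mkseq a n)| <= geometric (2 * (x + 1)) (1 / 2) n.
  have t0 : 0 <= cfrac_tail (drop (n %% size s) s) x by apply: cfrac_tail_ge0.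
  have t1 : cfrac_tail (drop (n %% size s) s) x <= x + 1.
    have : cf_digits (drop (n %% size s) s).
      by apply/allP => i /mem_drop; apply: (allP ds).
    case: drop => [|b u] /=; first by lra.
    move=> /andP[/digit_ge1 b1 _]; have := cfrac_tail_ge0 u x0.
    move: (cfrac_tail _ _) => w w0.
    by apply: (@le_trans _ _ 1); rewrite ?invf_le1; lra.
  have -> : cfrac_seq R (mkseq a n) = cfrac_tail (mkseq a n) 0 by [].
  rewrite [X in `|X - _|](cfrac_tail_stream n s0 sx) -/a.
  apply: (le_trans (cfrac_tail_contract (da n) t0 (lexx 0))).
  rewrite size_mkseq subr0 ger0_norm // /geometric /= mulrAC.
  by apply: ler_wpM2r; [exact: exprn_ge0 | lra].
have cv : geometric (2 * (x + 1)) (1 / 2) n @[n --> \oo] --> (0 : R).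
  by apply: cvg_geometric; rewrite ger0_norm; lra.
by apply: cvg_of_norm_le cv => n; rewrite distrC.
Qed.

End ContinuedFractions.

(** * Matrices of words, and how the Euclidean algorithm reads a word *)

Section WordMatrices.
Variable R : realType.
Implicit Types (s t : seq nat) (x y z : R) (A W : 'M[R]_2).

(** Its Möbius action is t |-> 1/(a + t). *)
Definition digit_mx (a : nat) : 'M[R]_2 := mx22 0 1 1 a%:R.

Definition word_mx s : 'M[R]_2 :=
  foldr (fun a A => digit_mx a *m A) 1%:M s.

Lemma word_mx_cat s t : word_mx (s ++ t) = word_mx s *m word_mx t.
Proof. by elim: s => [|a s IH] /=; rewrite ?mul1mx // IH mulmxA. Qed.

Lemma cfrac_tail_gt0 s y : 0 < y -> 0 < cfrac_tail s y.
Proof. by move=> y0; elim: s => //= a s IH; rewrite invr_gt0 ltr_wpDl. Qed.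

(** This is the Möbius action of the word matrix, cross-multiplied to stay free of division. *)
Lemma cfrac_tailE s y : 0 < y ->
  cfrac_tail s y * (word_mx s 1 0 * y + word_mx s 1 1)
  = word_mx s 0 0 * y + word_mx s 0 1.
Proof.
move=> y0; elim: s => [|a s IH] /=; first by rewrite !mxE /=; lra.
have t0 := cfrac_tail_gt0 s y0.
rewrite !mulmx22E !mxE /=.
set t := cfrac_tail s y in IH t0 *.
have -> : (1 * word_mx s 0 0 + a%:R * word_mx s 1 0) * y
    + (1 * word_mx s 0 1 + a%:R * word_mx s 1 1)
  = (a%:R + t) * (word_mx s 1 0 * y + word_mx s 1 1).
  by rewrite [RHS]mulrDl IH; ring.
by rewrite mulKf; [ring | rewrite gt_eqF // ltr_wpDl].
Qed.

(** The invariant of the algorithm: after [n] steps the matrix is [A], and [x] is the image of the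
    remainder [y] under the Möbius map of [A]. *)
Definition euclid_state x n A y :=
  [/\ forall i j, (euclid_mx x n i j)%:R = A i j, 0 < y,
      x * (A 1 0 * y + A 1 1) = A 0 0 * y + A 0 1 & \det A = 1].

Lemma euclid_state0 x : 0 < x -> euclid_state x 0 1%:M x.
Proof.
move=> x0; split; rewrite ?det1 ?mxE //=; last by lra.
by move=> i j; rewrite !mxE; case: eqP.
Qed.

(** The threshold is the image of 1 under the Möbius map of [A], and [x] is the image of [y].
    Determinant 1 makes this map increasing on the positive axis, so the algorithm in effect
    compares [y] with 1. *)
Lemma euclid_state_lt x n A y (E := euclid_mx x n) : euclid_state x n A y ->
  (x < (E 0 0 + E 0 1)%:R / (E 1 0 + E 1 1)%:R) = (y < 1).
Proof.
rewrite /E => -[e y0 xy]; rewrite det22 !natrD !e => d1.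
have := (ler0n R (euclid_mx x n 0 0), ler0n R (euclid_mx x n 0 1),
  ler0n R (euclid_mx x n 1 0), ler0n R (euclid_mx x n 1 1)).
rewrite !e => -[[[a0 b0] c0] dd0].
have cd : 0 < A 1 0 + A 1 1.
  rewrite lt_neqAle addr_ge0 // andbT; apply/eqP => h.
  have [c0' dd0'] : A 1 0 = 0 /\ A 1 1 = 0 by split; lra.
  by move: d1; rewrite c0' dd0'; lra.
have cyd : 0 < A 1 0 * y + A 1 1.
  rewrite lt_neqAle addr_ge0 ?(ltW y0) ?mulr_ge0 ?(ltW y0) // andbT.
  apply/eqP => h; have := mulr_ge0 c0 (ltW y0) => cy0.
  have dd0' : A 1 1 = 0 by lra.
  have cy : A 1 0 * y = 0 by lra.
  move/eqP: cy; rewrite mulf_eq0 (gt_eqF y0) orbF => /eqP c0'.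
  by move: d1; rewrite c0' dd0'; lra.
rewrite ltr_pdivlMr // -(ltr_pM2r cyd) mulrAC xy.
rewrite -subr_gt0 -[RHS]subr_gt0; congr (0 < _).
transitivity ((A 0 0 * A 1 1 - A 0 1 * A 1 0) * (1 - y)); first by ring.
by rewrite d1 mul1r.
Qed.

Lemma euclid_stateR x n A y : 0 < y -> euclid_state x n A (y / (1 + y)) ->
  euclid_state x n.+1 (A *m mx22 1 0 1 1) y.
Proof.
move=> y0 st; have lt := euclid_state_lt st; case: st => e _ xy d1.
split => //.
- move=> i j; rewrite /= lt ltr_pdivrMr; last by lra.
  rewrite (_ : y < _); last by lra.
  by rewrite !mulmx22E natrD !natrM !e !mxE; case: i j => [[|[]]] // ? [[|[]]].
- have h : 0 < 1 + y by lra.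
  rewrite !mulmx22E !mxE /=.
  have -> : (A 1 0 * 1 + A 1 1 * 1) * y + (A 1 0 * 0 + A 1 1 * 1)
    = (A 1 0 * (y / (1 + y)) + A 1 1) * (1 + y) by field; rewrite gt_eqF.
  by rewrite mulrA xy; field; rewrite gt_eqF.
- by rewrite det_mulmx d1 det22 !mxE /=; ring.
Qed.

Lemma euclid_stateL x n A y : 0 < y -> euclid_state x n A (1 + y) ->
  euclid_state x n.+1 (A *m mx22 1 1 0 1) y.
Proof.
move=> y0 st; have lt := euclid_state_lt st; case: st => e _ xy d1.
split => //.
- move=> i j; rewrite /= lt (_ : _ < 1 = false); last by apply/negbTE; lra.
  by rewrite !mulmx22E natrD !natrM !e !mxE; case: i j => [[|[]]] // ? [[|[]]].
- rewrite !mulmx22E !mxE /=.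
  have -> : (A 1 0 * 1 + A 1 1 * 0) * y + (A 1 0 * 1 + A 1 1 * 1)
    = A 1 0 * (1 + y) + A 1 1 by ring.
  by rewrite xy; ring.
- by rewrite det_mulmx d1 det22 !mxE /=; ring.
Qed.

(** A step R lowers the reciprocal of the remainder by 1, just as a step L lowers the remainder
    itself, so [k] steps consume a digit [k]. *)
Lemma euclid_state_iterR x n A k y : 0 < y ->
  euclid_state x n A (k%:R + y)^-1 ->
  euclid_state x (n + k) (A *m mx22 1 0 k%:R 1) y^-1.
Proof.
move=> y0; elim: k n A => [|k IH] n A st.
  rewrite addn0 (_ : mx22 _ _ _ _ = 1%:M) ?mulmx1; first by rewrite add0r in st.
  by apply/matrixP; do 2!apply: ord2P; rewrite !mxE.
have ky : 0 < k%:R + y by rewrite ltr_wpDl.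
rewrite addnS -addSn (_ : mx22 _ _ _ _ = mx22 1 0 1 1 *m mx22 1 0 k%:R 1).
  rewrite mulmxA; apply/IH/euclid_stateR; first by rewrite invr_gt0.
  rewrite (_ : _ / _ = (k.+1%:R + y)^-1) // -natr1.
  by field; apply/andP; split; apply/lt0r_neq0; lra.
by apply/matrixP; do 2!apply: ord2P; rewrite mulmx22E !mxE /= -?natr1; ring.
Qed.

Lemma euclid_state_iterL x n A k y : 0 < y ->
  euclid_state x n A (k%:R + y) ->
  euclid_state x (n + k) (A *m mx22 1 k%:R 0 1) y.
Proof.
move=> y0; elim: k n A => [|k IH] n A st.
  rewrite addn0 (_ : mx22 _ _ _ _ = 1%:M) ?mulmx1; first by rewrite add0r in st.
  by apply/matrixP; do 2!apply: ord2P; rewrite !mxE.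
have ky : 0 < k%:R + y by rewrite ltr_wpDl.
rewrite addnS -addSn (_ : mx22 _ _ _ _ = mx22 1 1 0 1 *m mx22 1 k%:R 0 1).
  rewrite mulmxA; apply/IH/euclid_stateL => //.
  by rewrite (_ : 1 + _ = k.+1%:R + y) // -natr1; ring.
by apply/matrixP; do 2!apply: ord2P; rewrite mulmx22E !mxE /= -?natr1; ring.
Qed.

(* Holds for words of even length; stated as a property because it is stable
   under concatenation. *)
Definition euclid_reads s := forall x n A y, 0 < y ->
  euclid_state x n A (cfrac_tail s y) ->
  euclid_state x (n + sumn s) (A *m word_mx s) y.

(** The first digit is read as R^a, the second as L^b, and R^a L^b is the product of the two digit
    matrices. *)
Lemma euclid_reads2 a b : euclid_reads [:: a; b].
Proof.
move=> x n A y y0 /= st.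
have by0 : 0 < b%:R + y by rewrite ltr_wpDl.
have := euclid_state_iterR _ st; rewrite invr_gt0 invrK => /(_ by0) st'.
have := euclid_state_iterL y0 st'.
rewrite -mulmxA addn0 addnA; congr (euclid_state _ _ (_ *m _) _).
by apply/matrixP; do 2!apply: ord2P; rewrite !mulmx22E !mxE /=; ring.
Qed.

Lemma euclid_reads_cat s t :
  euclid_reads s -> euclid_reads t -> euclid_reads (s ++ t).
Proof.
move=> hs ht x n A y y0; rewrite cfrac_tail_cat => /(hs _ _ _ _ _).
rewrite word_mx_cat mulmxA sumn_cat addnA => st.
by apply/(ht _ _ _ _ y0)/st/cfrac_tail_gt0.
Qed.

End WordMatrices.

(** * Hyperbolic matrices and the Lyapunov exponent of a periodic word *)

Section PositiveMatrices.
Variable R : realType.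
Implicit Types (W Z : 'M[R]_2).

Definition positive_sl2 W := (forall i j, 1 <= W i j) /\ \det W = 1.

Lemma positive_sl2_mul W Z :
  positive_sl2 W -> positive_sl2 Z -> positive_sl2 (W *m Z).
Proof.
move=> [w1 dw] [z1 dz]; split=> [i j|]; last by rewrite det_mulmx dw dz mulr1.
have := (w1 i 0, w1 i 1, z1 0 j, z1 1 j); rewrite mulmx22E => -[[[]]].
by move=> *; nra.
Qed.

(** The square root of the discriminant. In what follows a prime marks the conjugate, taken with the
    other sign of this root. *)
Definition discr W : R := Num.sqrt ((\tr W) ^+ 2 - 4).
Definition eigval W : R := (\tr W + discr W) / 2.
Definition eigval' W : R := (\tr W - discr W) / 2.
Definition fixpt W : R := (W 0 0 - W 1 1 + discr W) / (2 * W 1 0).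
Definition fixpt' W : R := (W 0 0 - W 1 1 - discr W) / (2 * W 1 0).

Section Facts.
Variable W : 'M[R]_2.
Hypothesis posW : positive_sl2 W.

Let det_entries : W 0 0 * W 1 1 - W 0 1 * W 1 0 = 1.
Proof. by case: posW => _; rewrite det22. Qed.

Lemma mxtrace_gt2 : 2 < \tr W.
Proof.
have [w1 _] := posW; rewrite mxtrace22.
have := (w1 0 0, w1 0 1, w1 1 0, w1 1 1) => -[[[a b] c] d].
by have := det_entries; nra.
Qed.

Lemma discr_sqr : discr W ^+ 2 = (\tr W) ^+ 2 - 4.
Proof. by rewrite sqr_sqrtr //; have := mxtrace_gt2; nra. Qed.

Lemma discr_gt0 : 0 < discr W.
Proof. by rewrite sqrtr_gt0; have := mxtrace_gt2; nra. Qed.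

(** The square of [discr W] is (W00 - W11)^2 + 4 W01 W10, and the last product is positive. Hence
    the two fixed points have opposite signs. *)
Lemma discr_gt : `|W 0 0 - W 1 1| < discr W.
Proof.
rewrite -(ltr_pXn2r (n := 2)) ?nnegrE ?(ltW discr_gt0) //.
rewrite discr_sqr real_normK ?num_real // mxtrace22.
have [w1 _] := posW; have := (w1 0 1, w1 1 0) => -[b c].
by have := det_entries; nra.
Qed.

Lemma eigval_sum : eigval W + eigval' W = \tr W.
Proof. by rewrite /eigval /eigval'; lra. Qed.

Lemma eigval_prod : eigval W * eigval' W = 1.
Proof. by rewrite /eigval /eigval'; have := discr_sqr; lra. Qed.

Lemma eigval_gt1 : 1 < eigval W.
Proof. by rewrite /eigval; have := discr_gt0; have := mxtrace_gt2; lra. Qed.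

Lemma eigval'_gt0 : 0 < eigval' W.
Proof. by rewrite -(pmulr_rgt0 _ (lt_trans ltr01 eigval_gt1)) eigval_prod. Qed.

Lemma eigval'_lt : eigval' W < eigval W.
Proof. by rewrite /eigval /eigval'; have := discr_gt0; lra. Qed.

Lemma fixpt_gt0 : 0 < fixpt W.
Proof.
have [w1 _] := posW; have := w1 1 0 => c.
have := discr_gt; rewrite ltr_norml => /andP[h _].
by rewrite divr_gt0 //; lra.
Qed.

Lemma fixpt'_lt0 : fixpt' W < 0.
Proof.
have [w1 _] := posW; have := w1 1 0 => c.
have := discr_gt; rewrite ltr_norml => /andP[_ h].
by rewrite pmulr_llt0 ?invr_gt0; lra.
Qed.

Let W10_neq0 : W 1 0 != 0.
Proof. by have [w1 _] := posW; apply/lt0r_neq0; have := w1 1 0; lra. Qed.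

Lemma eigval_fixpt : W 1 0 * fixpt W + W 1 1 = eigval W.
Proof. by rewrite /fixpt /eigval mxtrace22; field. Qed.

Lemma eigval_fixpt' : W 1 0 * fixpt' W + W 1 1 = eigval' W.
Proof. by rewrite /fixpt' /eigval' mxtrace22; field. Qed.

Let W10_fixpt : W 1 0 * fixpt W = (W 0 0 - W 1 1 + discr W) / 2.
Proof. by rewrite /fixpt; field. Qed.

Let W10_fixpt' : W 1 0 * fixpt' W = (W 0 0 - W 1 1 - discr W) / 2.
Proof. by rewrite /fixpt'; field. Qed.

Let discr_entries :
  discr W ^+ 2 = (W 0 0 - W 1 1) ^+ 2 + 4 * (W 0 1 * W 1 0).
Proof. by rewrite discr_sqr mxtrace22; have := det_entries; lra. Qed.

(** Together with [eigval_fixpt] this makes the column ([fixpt W], 1) an eigenvector for the larger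
    eigenvalue. *)
Lemma fixptE : W 0 0 * fixpt W + W 0 1 = eigval W * fixpt W.
Proof.
apply: (mulfI W10_neq0).
transitivity (W 0 0 * (W 1 0 * fixpt W) + W 0 1 * W 1 0); first by ring.
transitivity (eigval W * (W 1 0 * fixpt W)); last by ring.
by rewrite W10_fixpt /eigval mxtrace22; have := discr_entries; lra.
Qed.

Lemma fixptE' : W 0 0 * fixpt' W + W 0 1 = eigval' W * fixpt' W.
Proof.
apply: (mulfI W10_neq0).
transitivity (W 0 0 * (W 1 0 * fixpt' W) + W 0 1 * W 1 0); first by ring.
transitivity (eigval' W * (W 1 0 * fixpt' W)); last by ring.
by rewrite W10_fixpt' /eigval' mxtrace22; have := discr_entries; lra.
Qed.

Lemma fixpt_pow k :
  ((W ^+ k) 0 0 * fixpt W + (W ^+ k) 0 1 = eigval W ^+ k * fixpt W) *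
  ((W ^+ k) 1 0 * fixpt W + (W ^+ k) 1 1 = eigval W ^+ k).
Proof.
elim: k => [|k [IH0 IH1]]; first by rewrite !expr0 !mxE /=; split; ring.
have row i : (W ^+ k.+1) i 0 * fixpt W + (W ^+ k.+1) i 1
    = ((W ^+ k) i 0 * fixpt W + (W ^+ k) i 1) * eigval W.
  rewrite exprSr -mulmxE !mulmx22E.
  transitivity ((W ^+ k) i 0 * (W 0 0 * fixpt W + W 0 1)
    + (W ^+ k) i 1 * (W 1 0 * fixpt W + W 1 1)); first by ring.
  by rewrite fixptE eigval_fixpt; ring.
by rewrite !row IH0 IH1 exprSr mulrAC; split; ring.
Qed.

(* The fixed points are the roots of c t^2 + (d - a) t - b. *)
Lemma fixpt_factor t :
  t * (W 1 0 * t + W 1 1) - (W 0 0 * t + W 0 1)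
  = W 1 0 * (t - fixpt W) * (t - fixpt' W).
Proof.
apply: (mulfI W10_neq0); set c := W 1 0.
transitivity ((c * t) ^+ 2 - (W 0 0 - W 1 1) * (c * t) - W 0 1 * c); first by ring.
transitivity ((c * t - c * fixpt W) * (c * t - c * fixpt' W)); last by ring.
by rewrite W10_fixpt W10_fixpt'; have := discr_entries; rewrite -/c; lra.
Qed.
End Facts.

End PositiveMatrices.

(** * Growth of the algorithm's matrices along a periodic word *)

Section LyapunovOfWords.
Variable R : realType.
Implicit Types (s t : seq nat) (x y z : R).

Definition admissible s := [/\ s != [::], cf_digits s, euclid_reads R s
  & positive_sl2 (word_mx R s)].

Lemma admissible_cat s t : admissible s -> admissible t -> admissible (s ++ t).
Proof.
move=> [s0 ds rs ps] [t0 dt rt pt]; split.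
- by case: (s) s0.
- by rewrite /cf_digits all_cat; apply/andP.
- exact: euclid_reads_cat.
- by rewrite word_mx_cat; apply: positive_sl2_mul.
Qed.

Lemma admissible2 a b : (0 < a)%N -> (0 < b)%N -> admissible [:: a; b].
Proof.
move=> a0 b0; split=> //=; first by rewrite a0 b0.
  exact: euclid_reads2.
have [a1 b1] := (digit_ge1 R a0, digit_ge1 R b0).
split; last by rewrite det22 /= !mulmx22E !mxE /=; ring.
by do 2!apply: ord2P; rewrite /= !mulmx22E !mxE /= ?mulmx22E ?mxE /=; nra.
Qed.

Lemma max_entry_ge (A : 'M[nat]_2) i j : (A i j <= max_entry A)%N.
Proof.
apply: (leq_trans _ (leq_bigmax i)).
by apply: (@leq_bigmax _ (fun j => A i j) j).
Qed.

Lemma max_entry_le (A : 'M[nat]_2) x : 0 <= x ->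
  (forall i j, (A i j)%:R <= x) -> (max_entry A)%:R <= x.
Proof.
move=> x0 h; rewrite /max_entry.
elim/big_ind: _ => // [m n hm hn|i _]; first by rewrite /maxn; case: ifP.
by elim/big_ind: _ => // m n hm hn; rewrite /maxn; case: ifP.
Qed.

(** Multiplying by [Lmx] or [Rmx] on the right adds one column to the other, so no entry ever
    decreases. *)
Lemma max_entry_euclid_homo x m n : (m <= n)%N ->
  (max_entry (euclid_mx x m) <= max_entry (euclid_mx x n))%N.
Proof.
apply: (@homo_leq _ (fun k => max_entry (euclid_mx x k)) leq leqnn) => [l k p|k].
  exact: leq_trans.
set A := euclid_mx x k; set B := euclid_mx x k.+1.
have AB i j : (A i j <= B i j)%N.
  rewrite /B /= -/A mulmx22E; case: ifP => _; rewrite !mxE;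
  by move: j; apply: ord2P => /=; rewrite ?mulr1 ?mulr0 ?addr0 ?add0r ?leq_addr ?leq_addl.
apply/bigmax_leqP => i _; apply/bigmax_leqP => j _.
exact: leq_trans (AB i j) (max_entry_ge _ _ _).
Qed.

Section Periodic.
Variable s : seq nat.
Hypothesis adm : admissible s.
Let W := word_mx R s.
Let posW : positive_sl2 W. Proof. by case: adm. Qed.
Let lam := eigval W.
Let xi := fixpt W.
Let xi0 : 0 < xi. Proof. exact: fixpt_gt0. Qed.
Let lam1 : 1 < lam. Proof. exact: eigval_gt1. Qed.

Lemma cfrac_tail_fixpt : cfrac_tail s xi = xi.
Proof.
have := cfrac_tailE s xi0; rewrite -/W (eigval_fixpt posW) (fixptE posW) mulrC.
by move/mulfI; apply; rewrite gt_eqF // (lt_trans ltr01).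
Qed.

Lemma cfrac_periodic_fixpt : cfrac_periodic R s = xi.
Proof.
case: adm => s0 ds _ _.
exact: cfrac_periodicE s0 ds (ltW xi0) cfrac_tail_fixpt.
Qed.

(** The remainder returns to [xi] after each period, which contributes one factor [W]. *)
Lemma euclid_state_period k : euclid_state xi (sumn s * k) (W ^+ k) xi.
Proof.
elim: k => [|k IH]; first by rewrite muln0 expr0; apply: euclid_state0.
case: adm => _ _ rs _.
by rewrite mulnS addnC exprSr -mulmxE; apply: rs; rewrite ?cfrac_tail_fixpt.
Qed.

Let w n : R := (max_entry (euclid_mx xi n))%:R.

(** By [fixpt_pow], [lam ^+ k] combines two entries of [W ^+ k] with weights [xi] and 1. *)
Lemma max_entry_period_ge k : lam ^+ k <= (1 + xi) * w (sumn s * k).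
Proof.
have [e _ _ _] := euclid_state_period k.
have [_ <-] := fixpt_pow posW k.
have ge i j : (W ^+ k) i j <= w (sumn s * k).
  by rewrite -e ler_nat max_entry_ge.
by rewrite -/xi; have := (xi0, ge 1 0, ge 1 1) => -[[? ?] ?]; nra.
Qed.

(** All terms in the two identities of [fixpt_pow] are nonnegative, so each entry is at most the
    right-hand side divided by its weight: [lam ^+ k] times 1, [xi] or [xi^-1]. *)
Lemma max_entry_period_le k : w (sumn s * k) <= (1 + xi + xi^-1) * lam ^+ k.
Proof.
have [e _ _ _] := euclid_state_period k.
have [e0 e1] := fixpt_pow posW k.
have ge0 i j : 0 <= (W ^+ k) i j by rewrite -e.
have l0 : 0 <= lam ^+ k by rewrite exprn_ge0 // ltW // (lt_trans ltr01).
have x0 : 0 < xi := xi0; have xiV : 0 < xi^-1 by rewrite invr_gt0.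
have m l : l <= 1 + xi + xi^-1 -> l * lam ^+ k <= (1 + xi + xi^-1) * lam ^+ k.
  exact: ler_wpM2r.
have m1 := m 1; have mx := m xi; have mv := m xi^-1.
move: e0 e1; rewrite -/xi -/lam => e0 e1.
apply: max_entry_le; first by rewrite mulr_ge0 //; lra.
move=> i j; rewrite e; move: i j; do 2!apply: ord2P.
- apply: le_trans (m1 _); last by lra.
  rewrite mul1r -(ler_pM2r xi0) -e0; have := ge0 0 1; lra.
- apply: le_trans (mx _); last by lra.
  rewrite mulrC -e0; have := mulr_ge0 (ge0 0 0) (ltW xi0); lra.
- apply: le_trans (mv _); last by lra.
  rewrite mulrC ler_pdivlMr // -e1; have := ge0 1 1; lra.
- apply: le_trans (m1 _); last by lra.
  by rewrite mul1r -e1; have := mulr_ge0 (ge0 1 0) (ltW xi0); lra.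
Qed.

(** Monotonicity squeezes [ln (w n)] between its bounds at the two neighbouring multiples of the
    period, so it stays within a constant of n ln(lam)/N. The quotients therefore converge, and the
    limsup is their limit. *)
Lemma Lyapunov_periodic : (0 < sumn s)%N ->
  Lyapunov xi = ln lam / (sumn s)%:R.
Proof.
move=> N0; set N := sumn s.
have NR : 0 < N%:R :> R by rewrite ltr0n.
have l0 : 0 <= ln lam by rewrite ln_ge0 // ltW.
have x0 : 0 < xi := xi0; have xiV : 0 < xi^-1 by rewrite invr_gt0.
(* One summand for rounding [n] to a multiple of the period, and one for each constant in the bounds
   on [w] at full periods. *)
pose D := ln lam + ln (1 + xi) + ln (1 + xi + xi^-1).
have lx0 : 0 <= ln (1 + xi) by rewrite ln_ge0; lra.
have lv0 : 0 <= ln (1 + xi + xi^-1) by rewrite ln_ge0; lra.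
have lamk k : 0 < lam ^+ k by rewrite exprn_gt0 // (lt_trans ltr01).
have w0 n : 0 < w n.
  have : (max_entry (euclid_mx xi 0) <= max_entry (euclid_mx xi n))%N.
    exact: max_entry_euclid_homo.
  have := max_entry_ge (euclid_mx xi 0) 0 0; rewrite /= mxE /= => h1 h2.
  by rewrite ltr0n (leq_trans h1).
have bnd n : `|ln (w n) - n%:R * (ln lam / N%:R)| <= D.
  pose k := (n %/ N)%N.
  have k1 : (N * k <= n)%N by rewrite mulnC leq_divM.
  have k2 : (n <= N * k.+1)%N by rewrite mulnC ltnW // ltn_ceil.
  have kn : k%:R * ln lam <= n%:R * (ln lam / N%:R) <= (k%:R + 1) * ln lam.
    have -> : n%:R * (ln lam / N%:R) = n%:R / N%:R * ln lam by ring.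
    apply/andP; split; apply: ler_wpM2r => //.
      by rewrite ler_pdivlMr // -natrM ler_nat mulnC.
    by rewrite ler_pdivrMr // natr1 -natrM ler_nat mulnC.
  have lo : k%:R * ln lam - ln (1 + xi) <= ln (w n).
    have : lam ^+ k <= (1 + xi) * w n.
      apply: (le_trans (max_entry_period_ge k)); apply: ler_wpM2l; first by lra.
      by rewrite ler_nat max_entry_euclid_homo.
    rewrite -ler_ln ?posrE ?mulr_gt0 //; last by lra.
    rewrite lnM ?posrE //; last by lra.
    by rewrite lnXn ?(lt_trans ltr01) // -[ln lam *+ _]mulr_natl; lra.
  have hi : ln (w n) <= (k%:R + 1) * ln lam + ln (1 + xi + xi^-1).
    have : w n <= (1 + xi + xi^-1) * lam ^+ k.+1.
      apply: (le_trans _ (max_entry_period_le k.+1)).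
      by rewrite ler_nat max_entry_euclid_homo.
    rewrite -ler_ln ?posrE ?mulr_gt0 //; last by lra.
    rewrite lnM ?posrE //; last by lra.
    by rewrite lnXn ?(lt_trans ltr01) // -[ln lam *+ _]mulr_natl -natr1; lra.
  by rewrite ler_norml /D; move: kn => /andP[kn1 kn2]; apply/andP; split; lra.
have D0 : ln lam / N%:R <= D.
  have : ln lam / N%:R <= ln lam by rewrite ler_pdivrMr // ler_peMr // ler1n.
  by rewrite /D; lra.
have lN0 : 0 <= ln lam / N%:R by rewrite divr_ge0 // ltW.
have cv : (fun n => ln (w n) / n%:R) @ \oo --> ln lam / N%:R.
  (* [harmonic n] is 1/(n + 1), so the factor 2 covers 1/n for positive [n]. At [n = 0] division by
     zero gives 0, and [D0] bounds the difference. *)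
  apply: (@cvg_of_norm_le _ _ (fun n => 2 * D * harmonic n)) => [n|].
    rewrite /harmonic /=; case: n => [|n].
      by rewrite invr0 mulr0 sub0r normrN ger0_norm // invr1 mulr1; lra.
    have n0 : 0 < n.+1%:R :> R by rewrite ltr0n.
    have -> : ln (w n.+1) / n.+1%:R - ln lam / N%:R
      = (ln (w n.+1) - n.+1%:R * (ln lam / N%:R)) / n.+1%:R.
      by field; rewrite !gt_eqF.
    rewrite normrM [`|_^-1|]gtr0_norm ?invr_gt0 // ler_pdivrMr //.
    apply: (le_trans (bnd _)); rewrite mulrAC.
    rewrite -[n.+2%:R]natr1 ler_pdivlMr; last by lra.
    have n1 : 1 <= n.+1%:R :> R by rewrite ler1n.
    nra.
  by rewrite -[X in _ --> X](mulr0 (2 * D)); apply: cvgMl_tmp cvg_harmonic.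
rewrite /Lyapunov cvg_limn_supE; first exact: cvg_lim.
by apply/cvg_ex; exists (ln lam / N%:R).
Qed.

End Periodic.
End LyapunovOfWords.

(** * The Farey tree *)

Record farey_node := FareyNode { fnum : nat; fden : nat; fword : seq nat }.

Definition mediant l r :=
  FareyNode (fnum l + fnum r) (fden l + fden r) (fword r ++ fword l).

Inductive farey_tree : farey_node -> farey_node -> farey_node -> Prop :=
| FareyRoot l r : farey_tree l r (mediant l r)
| FareyLeft l r z : farey_tree l (mediant l r) z -> farey_tree l r z
| FareyRight l r z : farey_tree (mediant l r) r z -> farey_tree l r z.

Definition farey_neighbours l r :=
  (fnum r * fden l = fnum l * fden r + 1)%N.

Definition farey_zero := FareyNode 0 1 [:: 1; 1]%N.
Definition farey_half := FareyNode 1 2 [:: 2; 2]%N.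

Definition farey_closed_tree z :=
  [\/ z = farey_zero, z = farey_half | farey_tree farey_zero farey_half z].

Section FareyTree.
Local Open Scope nat_scope.
Implicit Types (l r z : farey_node).

Lemma farey_tree_closed (P : farey_node -> Prop) l r z :
  (forall x y, P x -> P y -> P (mediant x y)) ->
  P l -> P r -> farey_tree l r z -> P z.
Proof.
move=> PM + + t; elim: t => {l r z} [l r|l r z _ IH|l r z _ IH] Pl Pr.
- exact: PM.
- by apply: IH => //; apply: PM.
- by apply: IH => //; apply: PM.
Qed.

Lemma farey_tree_coord l r z : farey_tree l r z -> exists i j,
  [/\ 0 < i, 0 < j, fnum z = i * fnum l + j * fnum r
    & fden z = i * fden l + j * fden r].
Proof.
elim=> {l r z} [l r|l r z _|l r z _]; first by exists 1, 1; rewrite /= !mul1n.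
  by move=> [i [j [i0 j0 /= -> ->]]]; exists (i + j), j; split; lia.
by move=> [i [j [i0 j0 /= -> ->]]]; exists i, (i + j); split; lia.
Qed.

Lemma farey_tree_between l r z : farey_neighbours l r -> farey_tree l r z ->
  fnum l * fden z < fnum z * fden l /\ fnum z * fden r < fnum r * fden z.
Proof.
rewrite /farey_neighbours => n /farey_tree_coord[i [j [i0 j0 -> ->]]].
by split; nia.
Qed.

Lemma cross_mul_lt_trans a b c d e f :
  a * d < c * b -> c * f < e * d -> a * f < e * b.
Proof.
move=> h1 h2; have b0 : 0 < b by case: (b) h1 => //; rewrite muln0.
have d0 : 0 < d by case: (d) h2 => //; rewrite muln0.
have h3 : a * d * f <= c * b * f by rewrite leq_mul2r ltnW ?orbT.
have h4 : c * f * b < e * d * b by rewrite ltn_pmul2r.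
by rewrite -(ltn_pmul2l d0); lia.
Qed.

(** The branches of [farey_descent] match the constructors of [farey_tree]. Running out of fuel
    strictly between the ends would contradict [farey_between]. *)
Lemma farey_descent_tree n p q u p' q' v a b :
  p' * q = p * q' + 1 -> 0 < q -> 0 < q' -> 0 < b -> coprime a b ->
  p * b < a * q -> a * q' < p' * b -> b < n + q + q' ->
  farey_tree (FareyNode p q u) (FareyNode p' q' v)
    (FareyNode a b (farey_descent n p q u p' q' v a b)).
Proof.
elim: n p q u p' q' v => [|n IH] p q u p' q' v h q0 q'0 b0 cab h1 h2 hn.
  have := farey_between h h1 h2; lia.
rewrite /= gtn_eqF // ltn_eqF //.
(* Both fractions are in lowest terms, so a target equal to the mediant in value is the mediant
   itself. *)
have med : a * (q + q') = (p + p') * b -> a = p + p' /\ b = q + q'.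
  apply: eq_coprime_fraction => //.
  by apply: (proj2 (@farey_coprime p q (p + p') (q + q') _)); lia.
case: leqP => [|lt].
  rewrite leq_eqVlt => /orP[/eqP /med[ea eb]|lt].
    have e : farey_descent n p q u (p + p') (q + q') (v ++ u) a b = v ++ u.
      by case: (n) => [|m] /=; rewrite gtn_eqF // -ea -eb eqxx.
    by rewrite e ea eb; exact: (FareyRoot (FareyNode p q u) (FareyNode p' q' v)).
  by apply: FareyLeft; apply: IH => //=; lia.
by apply: FareyRight; apply: IH => //=; lia.
Qed.

Lemma farey_closed_treeP (x : rat) : farey_domain x -> exists z,
  [/\ farey_closed_tree z, farey_word x = fword z
    & x = ((fnum z)%:R / (fden z)%:R)%R].
Proof.
move=> /= /andP[x0 x1].
have [a [b [b0 cab ex]]] : exists a b, [/\ 0 < b, coprime a b & x = (a%:R / b%:R)%R].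
  exists `|numq x|, `|denq x|; split.
  - by rewrite absz_gt0 denq_neq0.
  - exact: coprime_num_den.
  rewrite -[LHS]divq_num_den; congr (_ / _)%R.
    by rewrite -[in LHS](@gez0_abs (numq x)) // numq_ge0.
  by rewrite -[in LHS](@gtz0_abs (denq x)).
have le : 2 * a <= b.
  move: x1; rewrite ex ler_pdivrMr ?ltr0n // mulrAC ler_pdivlMr // mul1r.
  by rewrite -natrM ler_nat mulnC.
have [a0|a0] := posnP a.
  exists farey_zero; split; first by constructor.
  - by rewrite ex a0 mul0r farey_word0.
  - by rewrite ex a0 !mul0r.
have [e|ne] := eqVneq (2 * a) b.
  have [ea eb] : a = 1 /\ b = 2 by apply: eq_coprime_fraction => //; lia.
  exists farey_half; split; first by constructor.
  - by rewrite ex ea eb farey_word_half.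
  - by rewrite ex ea eb.
exists (FareyNode a b (farey_word x)); split=> //.
rewrite ex farey_wordE //; apply: Or33; apply: farey_descent_tree => //; lia.
Qed.

End FareyTree.

(** * Supporting lines *)

Section SupportingLine.
Variable R : realType.
Variable g : seq nat -> 'M[R]_2.
Hypothesis g_cat : forall s t, g (s ++ t) = g s *m g t.
Implicit Types (l r c z : farey_node) (d : R).

Let gw z := g (fword z).

Let gw_mediant l r : gw (mediant l r) = gw r *m gw l.
Proof. exact: g_cat. Qed.

(** Additive under mediants, as suits a lower bound for the logarithms of supermultiplicative
    entries. In the application, [g] gives the word matrices in the eigenbasis of one node. *)
Definition linear_form (st : R * R) z : R :=
  st.1 * (fnum z)%:R + st.2 * (fden z)%:R.

Lemma linear_form_mediant st l r :
  linear_form st (mediant l r) = linear_form st l + linear_form st r.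
Proof. by rewrite /linear_form /= !natrD; ring. Qed.

Lemma expR_form_mediant st l r : expR (linear_form st (mediant l r))
  = expR (linear_form st l) * expR (linear_form st r).
Proof. by rewrite linear_form_mediant [LHS]expRD. Qed.

Lemma expRN_form_mediant st l r : expR (- linear_form st (mediant l r))
  = expR (- linear_form st l) * expR (- linear_form st r).
Proof. by rewrite linear_form_mediant opprD [LHS]expRD. Qed.

Lemma expR_mulN (x : R) : expR x * expR (- x) = 1.
Proof. by rewrite expRN mulfV // gt_eqF // expR_gt0. Qed.

(** Farey neighbours form a basis of determinant 1, so Cramer's rule needs no division. *)
Lemma linear_form_interp l r (a b : R) : farey_neighbours l r ->
  exists st, linear_form st l = a /\ linear_form st r = b.
Proof.
rewrite /farey_neighbours => /(congr1 (fun n => n%:R : R)).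
rewrite natrD !natrM => n.
exists (b * (fden l)%:R - a * (fden r)%:R, a * (fnum r)%:R - b * (fnum l)%:R).
rewrite /linear_form /=; split.
  transitivity (a * ((fnum r)%:R * (fden l)%:R - (fnum l)%:R * (fden r)%:R)).
    by ring.
  by rewrite n; ring.
transitivity (b * ((fnum r)%:R * (fden l)%:R - (fnum l)%:R * (fden r)%:R)).
  by ring.
by rewrite n; ring.
Qed.

(* The second bound says that the inverse of [gw z] has upper left entry at
   least [expR (- linear_form st z)]. *)
Definition dominates st d z :=
  [/\ expR (linear_form st z) <= gw z 0 0, expR (- linear_form st z) <= gw z 1 1,
      0 <= d * gw z 0 1 & 0 <= d * gw z 1 0].

(** Off-diagonal entries of a common sign have nonnegative products, so the diagonal entries of the
    product are at least the products of the diagonal entries. *)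
Lemma dominates_mediant st d l r : d ^+ 2 = 1 ->
  dominates st d l -> dominates st d r -> dominates st d (mediant l r).
Proof.
move=> d1 [l00 l11 l01 l10] [r00 r11 r01 r10].
rewrite /dominates expR_form_mediant expRN_form_mediant gw_mediant !mulmx22E.
move: (expR_gt0 (linear_form st l)) (expR_gt0 (linear_form st r)).
move: (expR_gt0 (- linear_form st l)) (expR_gt0 (- linear_form st r)).
move: l00 l11 r00 r11; set a := expR _; set a' := expR (- _).
set b := expR (linear_form st r); set b' := expR (- linear_form st r).
move=> l00 l11 r00 r11 a'0 b'0 a0 b0.
have p1 : 0 <= gw r 0 1 * gw l 1 0.
  by rewrite -[X in 0 <= X]mul1r -d1; have := mulr_ge0 r01 l10; lra.
have p2 : 0 <= gw r 1 0 * gw l 0 1.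
  by rewrite -[X in 0 <= X]mul1r -d1; have := mulr_ge0 r10 l01; lra.
have l0 : 0 <= gw l 0 0 by lra.
have l1 : 0 <= gw l 1 1 by lra.
have r0 : 0 <= gw r 0 0 by lra.
have r1 : 0 <= gw r 1 1 by lra.
split.
- have := ler_pM (ltW a0) (ltW b0) l00 r00; lra.
- have := ler_pM (ltW a'0) (ltW b'0) l11 r11; lra.
- have := mulr_ge0 r0 l01; have := mulr_ge0 r01 l1; lra.
- have := mulr_ge0 r10 l0; have := mulr_ge0 r1 l10; lra.
Qed.

Lemma dominates_tree st d l r z : d ^+ 2 = 1 -> farey_tree l r z ->
  dominates st d l -> dominates st d r -> dominates st d z.
Proof.
move=> d1 t dl dr; apply: (farey_tree_closed _ dl dr t) => x y.
exact: dominates_mediant.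
Qed.

(** Right multiplication by the adjugate of [X], which is its inverse in determinant 1. *)
Lemma mulmx22_divr (Y X M : 'M[R]_2) : \det X = 1 -> Y *m X = M ->
  [/\ Y 0 0 = M 0 0 * X 1 1 - M 0 1 * X 1 0, Y 0 1 = M 0 1 * X 0 0 - M 0 0 * X 0 1,
      Y 1 0 = M 1 0 * X 1 1 - M 1 1 * X 1 0 & Y 1 1 = M 1 1 * X 0 0 - M 1 0 * X 0 1].
Proof.
rewrite det22 => dX <-; rewrite !mulmx22E.
have e (y : R) : y = y * (X 0 0 * X 1 1 - X 0 1 * X 1 0) by rewrite dX mulr1.
by split; [rewrite [LHS]e | rewrite [LHS]e | rewrite [LHS]e | rewrite [LHS]e]; ring.
Qed.

Lemma mulmx22_divl (Y X M : 'M[R]_2) : \det Y = 1 -> Y *m X = M ->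
  [/\ X 0 0 = Y 1 1 * M 0 0 - Y 0 1 * M 1 0, X 0 1 = Y 1 1 * M 0 1 - Y 0 1 * M 1 1,
      X 1 0 = Y 0 0 * M 1 0 - Y 1 0 * M 0 0 & X 1 1 = Y 0 0 * M 1 1 - Y 1 0 * M 0 1].
Proof.
rewrite det22 => dY <-; rewrite !mulmx22E.
have e (y : R) : y = y * (Y 0 0 * Y 1 1 - Y 0 1 * Y 1 0) by rewrite dY mulr1.
by split; [rewrite [LHS]e | rewrite [LHS]e | rewrite [LHS]e | rewrite [LHS]e]; ring.
Qed.

(** The matrix of [r] is that of the mediant times the inverse of that of [l]. Inversion swaps the
    diagonal entries and negates the others, turning sign [- d] into [d], after which the argument
    for mediants applies. *)
Lemma dominates_right st d l r : d ^+ 2 = 1 -> \det (gw l) = 1 ->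
  dominates st (- d) l -> dominates st d (mediant l r) -> dominates st d r.
Proof.
move=> d1 dl [l00 l11 l01 l10]; rewrite /dominates.
rewrite expR_form_mediant expRN_form_mediant.
have lr : gw r *m gw l = gw (mediant l r) by rewrite gw_mediant.
have [-> -> -> ->] := mulmx22_divr dl lr.
move: (gw (mediant l r)) (expR_mulN (linear_form st l)) => M.
move: (expR_gt0 (linear_form st l)) (expR_gt0 (linear_form st r)).
move: (expR_gt0 (- linear_form st l)) (expR_gt0 (- linear_form st r)).
move: l00 l11; set a := expR _; set a' := expR (- _).
set b := expR (linear_form st r); set b' := expR (- linear_form st r).
move=> l00 l11 a'0 b'0 a0 b0 aa' [m00 m11 m01 m10].
have p1 : 0 <= - (M 0 1 * gw l 1 0).
  by rewrite -[X in 0 <= X]mul1r -d1; have := mulr_ge0 m01 l10; lra.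
have p2 : 0 <= - (M 1 0 * gw l 0 1).
  by rewrite -[X in 0 <= X]mul1r -d1; have := mulr_ge0 m10 l01; lra.
have l0 : 0 <= gw l 0 0 by lra.
have l1 : 0 <= gw l 1 1 by lra.
have ab := mulr_ge0 (ltW a0) (ltW b0); have ab' := mulr_ge0 (ltW a'0) (ltW b'0).
have m0 : 0 <= M 0 0 by lra.
have m1 : 0 <= M 1 1 by lra.
split.
- have := ler_pM ab (ltW a'0) m00 l11.
  by rewrite mulrAC aa'; lra.
- have := ler_pM ab' (ltW a0) m11 l00.
  by rewrite mulrAC (mulrC a') aa'; lra.
- have := mulr_ge0 m0 l01; have := mulr_ge0 m01 l0; lra.
- have := mulr_ge0 m10 l1; have := mulr_ge0 m1 l10; lra.
Qed.

(** Mirror image of [dominates_right], with the inverse as the left factor. *)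
Lemma dominates_left st d l r : d ^+ 2 = 1 -> \det (gw r) = 1 ->
  dominates st d r -> dominates st (- d) (mediant l r) -> dominates st (- d) l.
Proof.
move=> d1 dr [r00 r11 r01 r10]; rewrite /dominates.
rewrite expR_form_mediant expRN_form_mediant.
have lr : gw r *m gw l = gw (mediant l r) by rewrite gw_mediant.
have [-> -> -> ->] := mulmx22_divl dr lr.
move: (gw (mediant l r)) (expR_mulN (linear_form st r)) => M.
move: (expR_gt0 (linear_form st r)) (expR_gt0 (linear_form st l)).
move: (expR_gt0 (- linear_form st r)) (expR_gt0 (- linear_form st l)).
move: r00 r11; set b := expR _; set b' := expR (- _).
set a := expR (linear_form st l); set a' := expR (- linear_form st l).
move=> r00 r11 b'0 a'0 b0 a0 bb' [m00 m11 m01 m10].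
have p1 : 0 <= - (M 0 1 * gw r 1 0).
  by rewrite -[X in 0 <= X]mul1r -d1; have := mulr_ge0 m01 r10; lra.
have p2 : 0 <= - (M 1 0 * gw r 0 1).
  by rewrite -[X in 0 <= X]mul1r -d1; have := mulr_ge0 m10 r01; lra.
have r0 : 0 <= gw r 0 0 by lra.
have r1 : 0 <= gw r 1 1 by lra.
have ab := mulr_ge0 (ltW a0) (ltW b0); have ab' := mulr_ge0 (ltW a'0) (ltW b'0).
have m0 : 0 <= M 0 0 by lra.
have m1 : 0 <= M 1 1 by lra.
split.
- have := ler_pM ab (ltW b'0) m00 r11.
  by rewrite -mulrA bb'; lra.
- have := ler_pM ab' (ltW b0) m11 r00.
  by rewrite -mulrA (mulrC b') bb'; lra.
- have := mulr_ge0 r1 m01; have := mulr_ge0 r01 m1; lra.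
- have := mulr_ge0 r0 m10; have := mulr_ge0 r10 m0; lra.
Qed.

(** With each trace written as 3m, the last equation is Markov's: m1^2 + m2^2 + m3^2 = 3 m1 m2
    m3. *)
Definition markov_frame l r :=
  [/\ farey_neighbours l r, (\det (gw l) = 1 /\ \det (gw r) = 1),
      [/\ 0 < \tr (gw l), 0 < \tr (gw r) & 0 < \tr (gw r *m gw l)] &
      (\tr (gw l)) ^+ 2 + (\tr (gw r)) ^+ 2 + (\tr (gw r *m gw l)) ^+ 2
      = \tr (gw l) * \tr (gw r) * \tr (gw r *m gw l)].

(** By Cayley-Hamilton the new trace is zx - y. This is the Vieta involution: zx - y is the other
    root of the Markov equation, seen as a quadratic in y. *)
Lemma markov_frame_left l r : markov_frame l r -> markov_frame l (mediant l r).
Proof.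
rewrite /markov_frame gw_mediant => -[n [dl dr] [x0 y0 z0] m].
have e : \tr (gw r *m gw l *m gw l)
    = \tr (gw r *m gw l) * \tr (gw l) - \tr (gw r).
  transitivity (\tr (gw r *m gw l) * \tr (gw l) - \tr (gw r) * \det (gw l)).
    by rewrite !mxtrace22 det22 !mulmx22E; ring.
  by rewrite dl mulr1.
rewrite e; move: m x0 y0 z0; set x := \tr _; set y := \tr (gw r); set z := \tr _.
move=> m x0 y0 z0; split.
- by move: n; rewrite /farey_neighbours /=; lia.
- by rewrite det_mulmx dl dr mulr1.
(* The product of the two roots is x^2 + z^2, which makes the new trace positive. *)
- split=> //; rewrite -(pmulr_rgt0 _ y0).
  have -> : y * (z * x - y) = x ^+ 2 + z ^+ 2 by lra.
  by rewrite addr_gt0 // exprn_gt0.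
- transitivity (x ^+ 2 + y ^+ 2 + z ^+ 2 + z ^+ 2 * x ^+ 2 - 2 * (x * y * z)).
    by ring.
  by rewrite m; ring.
Qed.

Lemma markov_frame_right l r : markov_frame l r -> markov_frame (mediant l r) r.
Proof.
rewrite /markov_frame gw_mediant => -[n [dl dr] [x0 y0 z0] m].
have e : \tr (gw r *m (gw r *m gw l))
    = \tr (gw r *m gw l) * \tr (gw r) - \tr (gw l).
  transitivity (\tr (gw r *m gw l) * \tr (gw r) - \tr (gw l) * \det (gw r)).
    by rewrite !mxtrace22 det22 !mulmx22E; ring.
  by rewrite dr mulr1.
rewrite e; move: m x0 y0 z0; set x := \tr _; set y := \tr (gw r); set z := \tr _.
move=> m x0 y0 z0; split.
- by move: n; rewrite /farey_neighbours /=; lia.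
- by rewrite det_mulmx dl dr mulr1.
- split=> //; rewrite -(pmulr_rgt0 _ x0).
  have -> : x * (z * y - x) = y ^+ 2 + z ^+ 2 by lra.
  by rewrite addr_gt0 // exprn_gt0.
- transitivity (x ^+ 2 + y ^+ 2 + z ^+ 2 + z ^+ 2 * y ^+ 2 - 2 * (x * y * z)).
    by ring.
  by rewrite m; ring.
Qed.

(* At c = l + r the Markov equation reads
   X00 X11 (lam - mu)^2 = (lam + mu)^2 with X the matrix of l, so that the
   off-diagonal entries of X, and those of C X^-1, have a product >= 0. *)
Lemma supporting_form_mediant l r (lam mu : R) :
  markov_frame l r -> 0 < lam -> 0 < mu -> lam * mu = 1 ->
  gw (mediant l r) = mx22 lam 0 0 mu ->
  exists st d, [/\ d ^+ 2 = 1, linear_form st (mediant l r) = ln lam,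
    dominates st (- d) l & dominates st d r].
Proof.
move=> [n [dl dr] [x0 _ _] m] lam0 mu0 lm C.
have lr : gw r *m gw l = mx22 lam 0 0 mu by rewrite -C gw_mediant.
have [] := mulmx22_divr dl lr; rewrite !mxE /= => r00 r01 r10 r11.
move: m x0 (dl); rewrite lr !mxtrace22 r00 r11 !mxE /= det22 => m x0 d1.
set X := gw l in m x0 d1 r00 r01 r10 r11.
have key : X 0 0 * X 1 1 * (lam - mu) ^+ 2 = (lam + mu) ^+ 2.
  have : (X 0 0 + X 1 1) ^+ 2 + (lam * X 1 1 + mu * X 0 0) ^+ 2 + (lam + mu) ^+ 2
    = (lam * mu) * (X 0 0 + X 1 1) ^+ 2
      + (lam * X 1 1) ^+ 2 + (mu * X 0 0) ^+ 2
      + X 0 0 * X 1 1 * (lam ^+ 2 + mu ^+ 2).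
    by transitivity ((X 0 0 + X 1 1) * (lam * X 1 1 + mu * X 0 0) * (lam + mu)); [lra | ring].
  rewrite lm => h.
  have -> : (lam - mu) ^+ 2 = lam ^+ 2 + mu ^+ 2 - 2 * (lam * mu) by ring.
  have : (lam * X 1 1 + mu * X 0 0) ^+ 2
    = (lam * X 1 1) ^+ 2 + (mu * X 0 0) ^+ 2 + 2 * (lam * mu) * (X 0 0 * X 1 1).
    by ring.
  by rewrite lm; lra.
have key' : X 0 1 * X 1 0 * (lam - mu) ^+ 2 = 4.
  have -> : X 0 1 * X 1 0 = X 0 0 * X 1 1 - 1 by lra.
  have -> : 4 = 4 * (lam * mu) by rewrite lm mulr1.
  by rewrite mulrBl key; ring.
have off : 0 < X 0 1 * X 1 0.
  have : 0 < X 0 1 * X 1 0 * (lam - mu) ^+ 2 by rewrite key'.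
  have := sqr_ge0 (lam - mu); rewrite le_eqVlt => /orP[/eqP <-|h].
    by rewrite mulr0 ltxx.
  by rewrite pmulr_lgt0.
(* The diagonal entries have product 1 + X01 X10 > 1 and positive sum. *)
have X0 : 0 < X 0 0 by nra.
have X1 : 0 < X 1 1 by nra.
(* With this choice the first bound at [l] is an equality. At [r] the upper left entry is lam X11,
   which is at least lam / X00. *)
have [st [stl str]] := linear_form_interp (ln (X 0 0)) (ln lam - ln (X 0 0)) n.
exists st.
have [d [d1' d01 d10]] : exists d : R,
    [/\ d ^+ 2 = 1, 0 <= - d * X 0 1 & 0 <= - d * X 1 0].
  have [x01|x01] := ltP (X 0 1) 0.
    by exists 1; rewrite expr1n; split=> //; [lra | nra].
  by exists (-1); rewrite sqrrN expr1n; split=> //; [lra | nra].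
exists d; split=> //; first by rewrite linear_form_mediant stl str; lra.
  rewrite /dominates stl expRN lnK ?posrE //; split=> //.
  by rewrite -[X in X <= _]mul1r ler_pdivrMr //; lra.
have e : expR (ln lam - ln (X 0 0)) = lam / X 0 0.
  by rewrite expRD expRN !lnK ?posrE.
rewrite /dominates str expRN e r00 r01 r10 r11; split.
- by rewrite ler_pdivrMr //; nra.
- have -> : mu = lam^-1.
    by rewrite -[LHS]mul1r -(mulVf (lt0r_neq0 lam0)) -mulrA lm mulr1.
  by rewrite invf_div; lra.
- by have := mulr_ge0 (ltW lam0) d01; lra.
- by have := mulr_ge0 (ltW mu0) d10; lra.
Qed.

(** Induction on the path to [c]. The last step is [supporting_form_mediant]. Going back up, the end
    that the descent had replaced is recovered by [dominates_right] or [dominates_left], and the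
    subtree next to it follows by [dominates_tree]. *)
Lemma supporting_form l r c (lam mu : R) :
  farey_tree l r c -> markov_frame l r -> 0 < lam -> 0 < mu -> lam * mu = 1 ->
  gw c = mx22 lam 0 0 mu ->
  exists st d, [/\ d ^+ 2 = 1, linear_form st c = ln lam,
    dominates st (- d) l, dominates st d r &
    forall z, farey_tree l r z ->
      ((fnum z * fden c <= fnum c * fden z)%N -> dominates st (- d) z) /\
      ((fnum c * fden z <= fnum z * fden c)%N -> dominates st d z)].
Proof.
move=> t fr lam0 mu0 lm.
elim: t fr => {l r c} [l r|l r c t IH|l r c t IH] fr C.
- have [st [d [d1 stc dl dr]]] := supporting_form_mediant fr lam0 mu0 lm C.
  exists st, d; split=> // z.
  (* At [c] the matrix is diagonal, so either sign will do; both are required, since [c] lies on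
     both sides of itself. *)
  have dc e : dominates st e (mediant l r).
    rewrite /dominates C !mxE /= stc expRN lnK ?posrE // !mulr0; split=> //.
    by rewrite -[X in X <= _]mul1r ler_pdivrMr //; lra.
  have nd : (- d) ^+ 2 = 1 by rewrite sqrrN.
  have [nl _ _ _] := markov_frame_left fr; have [nr _ _ _] := markov_frame_right fr.
  move=> tz; inversion tz; subst.
  + by split=> _; apply: dc.
  + split=> [_|h]; first exact: (dominates_tree nd H dl).
    by have [_] := farey_tree_between nl H; rewrite ltnNge h.
  + split=> [h|_]; last exact: (dominates_tree d1 H _ dr).
    by have [+ _] := farey_tree_between nr H; rewrite ltnNge h.
- have frl := markov_frame_left fr; have frr := markov_frame_right fr.
  have [st [d [d1 stc dl dm h]]] := IH frl C.
  have [_ [ddl _] _ _] := fr.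
  have dr := dominates_right d1 ddl dl dm.
  exists st, d; split=> // z tz.
  have [nl _ _ _] := frl; have [nr _ _ _] := frr.
  have [_ cm] := farey_tree_between nl t.
  inversion tz; subst.
  + by split=> // h1; move: cm; rewrite ltnNge h1.
  + exact: h.
  + split=> [h1|_]; last exact: (dominates_tree d1 H).
    have [mz _] := farey_tree_between nr H.
    by have := cross_mul_lt_trans cm mz; rewrite ltnNge h1.
- have frl := markov_frame_left fr; have frr := markov_frame_right fr.
  have [st [d [d1 stc dm dr h]]] := IH frr C.
  have [_ [_ ddr] _ _] := fr.
  have nd : (- d) ^+ 2 = 1 by rewrite sqrrN.
  have dl := dominates_left d1 ddr dr dm.
  exists st, d; split=> // z tz.
  have [nl _ _ _] := frl; have [nr _ _ _] := frr.
  have [cm _] := farey_tree_between nr t.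
  inversion tz; subst.
  + by split=> // h1; move: cm; rewrite ltnNge h1.
  + split=> [_|h1]; first exact: (dominates_tree nd H).
    have [_ mz] := farey_tree_between nl H.
    by have := cross_mul_lt_trans mz cm; rewrite ltnNge h1.
  + exact: h.
Qed.

End SupportingLine.

(** * Conjugation to an eigenbasis *)

Section Eigenbasis.
Variable R : realType.
Variable W : 'M[R]_2.
Hypothesis posW : positive_sl2 W.
Implicit Type Z : 'M[R]_2.

Let xi := fixpt W.
Let eta := fixpt' W.

Let xi_eta : 0 < xi - eta.
Proof. by rewrite subr_gt0 (lt_trans (fixpt'_lt0 posW) (fixpt_gt0 posW)). Qed.

Let xi_eta0 : xi - eta != 0. Proof. exact: lt0r_neq0. Qed.

Definition eigmx : 'M[R]_2 := mx22 (fixpt W) (fixpt' W) 1 1.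
Definition eigmxV : 'M[R]_2 :=
  (fixpt W - fixpt' W)^-1 *: mx22 1 (- fixpt' W) (- 1) (fixpt W).

Definition eigconj Z := eigmxV *m Z *m eigmx.

Lemma eigmxVK : eigmxV *m eigmx = 1%:M.
Proof.
by apply/matrixP; do 2!apply: ord2P; rewrite !mulmx22E !mxE /= -/xi -/eta; field.
Qed.

Lemma eigmxK : eigmx *m eigmxV = 1%:M.
Proof. exact: mulmx1C eigmxVK. Qed.

Lemma eigconjM Z1 Z2 : eigconj (Z1 *m Z2) = eigconj Z1 *m eigconj Z2.
Proof.
by rewrite /eigconj -!mulmxA (mulmxA eigmx) eigmxK mul1mx.
Qed.

Lemma det_eigconj Z : \det (eigconj Z) = \det Z.
Proof. by rewrite !det_mulmx mulrAC -det_mulmx eigmxVK det1 mul1r. Qed.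

Lemma mxtrace_eigconj Z : \tr (eigconj Z) = \tr Z.
Proof. by rewrite mxtrace_mulC mulmxA eigmxK mul1mx. Qed.

Lemma eigconj_diag : eigconj W = mx22 (eigval W) 0 0 (eigval' W).
Proof.
have e : W *m eigmx = eigmx *m mx22 (eigval W) 0 0 (eigval' W).
  apply/matrixP; do 2!apply: ord2P; rewrite !mulmx22E !mxE /= !mulr1;
    rewrite ?mulr0 ?addr0 ?add0r ?mul1r.
  - by rewrite fixptE // mulrC.
  - by rewrite fixptE' // mulrC.
  - exact: eigval_fixpt.
  - exact: eigval_fixpt'.
by rewrite /eigconj -mulmxA e mulmxA eigmxVK mul1mx.
Qed.

Lemma eigconjE Z : [/\
  eigconj Z 0 0 = (Z 0 0 * xi + Z 0 1 - eta * (Z 1 0 * xi + Z 1 1)) / (xi - eta),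
  eigconj Z 0 1 = (Z 0 0 * eta + Z 0 1 - eta * (Z 1 0 * eta + Z 1 1)) / (xi - eta),
  eigconj Z 1 0 = (xi * (Z 1 0 * xi + Z 1 1) - (Z 0 0 * xi + Z 0 1)) / (xi - eta) &
  eigconj Z 1 1 = (xi * (Z 1 0 * eta + Z 1 1) - (Z 0 0 * eta + Z 0 1)) / (xi - eta)].
Proof. by split; rewrite !mulmx22E !mxE /= -/xi -/eta; field. Qed.

(** The lower left entry is, up to a positive factor, the fixed-point polynomial of [Z] at [xi]. Its
    factor at the negative root [fixpt' Z] is positive, so the sign is that of [xi - fixpt Z]. *)
Lemma eigconj10_ge0 Z : positive_sl2 Z ->
  (0 <= eigconj Z 1 0) = (fixpt Z <= xi).
Proof.
move=> pZ; have [_ _ -> _] := eigconjE Z; rewrite fixpt_factor //.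
have c0 : 0 < Z 1 0 by apply: lt_le_trans ltr01 _; case: pZ.
have x0 : 0 < xi - fixpt' Z.
  by rewrite subr_gt0 (lt_trans (fixpt'_lt0 pZ) (fixpt_gt0 posW)).
by rewrite pmulr_lge0 ?invr_gt0 // pmulr_lge0 // pmulr_rge0 // subr_ge0.
Qed.

Lemma eigconj10_le0 Z : positive_sl2 Z ->
  (eigconj Z 1 0 <= 0) = (xi <= fixpt Z).
Proof.
move=> pZ; have [_ _ -> _] := eigconjE Z; rewrite fixpt_factor //.
have c0 : 0 < Z 1 0 by apply: lt_le_trans ltr01 _; case: pZ.
have x0 : 0 < xi - fixpt' Z.
  by rewrite subr_gt0 (lt_trans (fixpt'_lt0 pZ) (fixpt_gt0 posW)).
by rewrite pmulr_lle0 ?invr_gt0 // pmulr_lle0 // pmulr_rle0 // subr_le0.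
Qed.

End Eigenbasis.

(** * Bounds for eigenvalues at the nodes of the Farey tree *)

Section SpectralBound.
Variable R : realType.

(** At X00 the characteristic polynomial t^2 - (X00 + X11) t + 1 takes the value 1 - X00 X11 <= 0,
    so X00 lies between the eigenvalues. *)
Lemma le_eigval (Z X : 'M[R]_2) : positive_sl2 Z -> \tr X = \tr Z ->
  1 <= X 0 0 * X 1 1 -> X 0 0 <= eigval Z.
Proof.
move=> pZ; rewrite mxtrace22 -eigval_sum => tX dX.
have := eigval_prod pZ; have := eigval'_lt pZ.
rewrite leNgt => lt prod; apply/negP => h.
have : 0 < (X 0 0 - eigval Z) * (X 0 0 - eigval' Z) by apply: mulr_gt0; lra.
have -> : (X 0 0 - eigval Z) * (X 0 0 - eigval' Z)
  = X 0 0 ^+ 2 - (eigval Z + eigval' Z) * X 0 0 + eigval Z * eigval' Z by ring.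
by rewrite prod -tX; lra.
Qed.

Definition node_mx z := word_mx R (fword z).

Definition node_lyapunov z : R := ln (eigval (node_mx z)) / (2 * fden z)%:R.

Lemma word_mx2 a : word_mx R [:: a; a] = mx22 1 a%:R a%:R (1 + a%:R ^+ 2).
Proof.
by apply/matrixP; do 2!apply: ord2P; rewrite /= !mulmx22E !mxE /= ?mulmx22E ?mxE /=; ring.
Qed.

Lemma farey_closed_tree_facts z : farey_closed_tree z ->
  [/\ admissible R (fword z), (0 < fden z)%N & sumn (fword z) = (2 * fden z)%N].
Proof.
case=> [->|->|]; try by split=> //; apply: admissible2.
apply: (@farey_tree_closed (fun z => [/\ admissible R (fword z),
  (0 < fden z)%N & sumn (fword z) = (2 * fden z)%N])); last first.
- by split=> //; apply: admissible2.
- by split=> //; apply: admissible2.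
move=> x y [ax dx sx] [ay dy sy]; split; first exact: admissible_cat.
  by rewrite addn_gt0 dx.
by rewrite sumn_cat sx sy /=; lia.
Qed.

Lemma node_positive z : farey_closed_tree z -> positive_sl2 (node_mx z).
Proof. by case/farey_closed_tree_facts => -[]. Qed.

(** Multiplied together, the two diagonal bounds give X00 X11 >= 1, as [le_eigval] requires. *)
Lemma dominates_le_eigval W st d z : positive_sl2 W -> farey_closed_tree z ->
  dominates (fun s => eigconj W (word_mx R s)) st d z ->
  linear_form st z <= ln (eigval (node_mx z)).
Proof.
move=> pW cz [h0 h1 _ _]; have pz := node_positive cz.
rewrite -[X in X <= _]expRK ler_ln ?posrE ?expR_gt0 //; last first.
  exact: lt_trans ltr01 (eigval_gt1 pz).
apply: (le_trans h0); apply: (le_eigval pz) => /=; first by rewrite mxtrace_eigconj.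
by rewrite -(expR_mulN (linear_form st z)) ler_pM ?expR_ge0.
Qed.

(** Traces and determinants are invariant under conjugation; the traces are 3, 6 and 15. *)
Lemma root_frame W : positive_sl2 W ->
  markov_frame (fun s => eigconj W (word_mx R s)) farey_zero farey_half.
Proof.
move=> pW; rewrite /markov_frame -eigconjM // !det_eigconj // !mxtrace_eigconj //.
rewrite /farey_zero /farey_half !word_mx2 !det22 !mxtrace22 !mulmx22E !mxE /=.
split; [by [] | by split; ring | by split; lra | by ring].
Qed.

Lemma node_mx_zero : node_mx farey_zero = mx22 1 1 1 2.
Proof. by rewrite /node_mx word_mx2 expr1n. Qed.

Lemma node_mx_half : node_mx farey_half = mx22 1 2 2 5.
Proof. by rewrite /node_mx word_mx2; congr mx22; ring. Qed.

Lemma fixpt_zero : fixpt (node_mx farey_zero) = (Num.sqrt 5 - 1) / 2.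
Proof.
rewrite /fixpt /discr node_mx_zero mxtrace22 !mxE /=.
rewrite (_ : (1 + 2) ^+ 2 - 4 = 5 :> R); last by ring.
by field.
Qed.

Lemma sqrt32 : Num.sqrt 32 = 4 * Num.sqrt 2 :> R.
Proof.
have -> : 32 = 4 ^+ 2 * 2 :> R by ring.
by rewrite sqrtrM ?sqr_ge0 // sqrtr_sqr ger0_norm.
Qed.

Lemma fixpt_half : fixpt (node_mx farey_half) = Num.sqrt 2 - 1.
Proof.
rewrite /fixpt /discr node_mx_half mxtrace22 !mxE /=.
rewrite (_ : (1 + 5) ^+ 2 - 4 = 32 :> R); last by ring.
by rewrite sqrt32; field.
Qed.

Lemma fixpt'_half : fixpt' (node_mx farey_half) = - Num.sqrt 2 - 1.
Proof.
rewrite /fixpt' /discr node_mx_half mxtrace22 !mxE /=.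
rewrite (_ : (1 + 5) ^+ 2 - 4 = 32 :> R); last by ring.
by rewrite sqrt32; field.
Qed.

Lemma eigval_zero : eigval (node_mx farey_zero) = ((1 + Num.sqrt 5) / 2) ^+ 2.
Proof.
have s5 : Num.sqrt 5 ^+ 2 = 5 :> R by rewrite sqr_sqrtr.
rewrite /eigval /discr node_mx_zero mxtrace22 !mxE /=.
rewrite (_ : (1 + 2) ^+ 2 - 4 = 5 :> R); last by ring.
by lra.
Qed.

Lemma eigval_half : eigval (node_mx farey_half) = (1 + Num.sqrt 2) ^+ 2.
Proof.
have s2 : Num.sqrt 2 ^+ 2 = 2 :> R by rewrite sqr_sqrtr.
rewrite /eigval /discr node_mx_half mxtrace22 !mxE /=.
rewrite (_ : (1 + 5) ^+ 2 - 4 = 32 :> R); last by ring.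
by rewrite sqrt32; lra.
Qed.

Lemma node_lyapunov_zero :
  node_lyapunov farey_zero = ln ((1 + Num.sqrt 5) / 2).
Proof.
have p : 0 < (1 + Num.sqrt 5) / 2 :> R by rewrite divr_gt0 // ltr_pwDl ?sqrtr_ge0.
by rewrite /node_lyapunov eigval_zero lnXn // -[_ *+ 2]mulr_natr mulfK.
Qed.

Lemma node_lyapunov_half :
  node_lyapunov farey_half = 1 / 2 * ln (1 + Num.sqrt 2).
Proof.
have p : 0 < 1 + Num.sqrt 2 :> R by rewrite ltr_pwDl ?sqrtr_ge0.
by rewrite /node_lyapunov eigval_half lnXn // -[_ *+ 2]mulr_natr natrM [fden _]/=; field.
Qed.

Lemma sqrt2_bounds : 7 / 5 < Num.sqrt (2 : R) < 3 / 2.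
Proof.
have s2 : Num.sqrt 2 ^+ 2 = 2 :> R by rewrite sqr_sqrtr.
by have s0 := sqrtr_ge0 (2 : R); apply/andP; split; nra.
Qed.

Lemma sqrt5_gt2 : 2 < Num.sqrt (5 : R).
Proof.
have s5 : Num.sqrt 5 ^+ 2 = 5 :> R by rewrite sqr_sqrtr.
by have := sqrtr_ge0 (5 : R); nra.
Qed.

Lemma fixpt_half_lt_zero :
  fixpt (node_mx farey_half) < fixpt (node_mx farey_zero).
Proof.
rewrite fixpt_half fixpt_zero; have := sqrt5_gt2.
by have /andP[] := sqrt2_bounds; lra.
Qed.

(** In the eigenbasis at [c], the diagonal entries of the other nodes yield the supporting form and
    the lower left entries the order of the fixed points. *)
Lemma node_support c : farey_tree farey_zero farey_half c ->
  (exists st, linear_form st c = ln (eigval (node_mx c)) /\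
    forall z, farey_closed_tree z ->
      linear_form st z <= ln (eigval (node_mx z))) /\
  (forall z, farey_closed_tree z ->
    ((fnum z * fden c <= fnum c * fden z)%N ->
      fixpt (node_mx c) <= fixpt (node_mx z)) /\
    ((fnum c * fden z <= fnum z * fden c)%N ->
      fixpt (node_mx z) <= fixpt (node_mx c))).
Proof.
move=> t; have cc : farey_closed_tree c by constructor.
have pc := node_positive cc; set W := node_mx c in pc *.
have gM s1 s2 : eigconj W (word_mx R (s1 ++ s2))
    = eigconj W (word_mx R s1) *m eigconj W (word_mx R s2).
  by rewrite word_mx_cat eigconjM.
have lam0 : 0 < eigval W by apply: lt_trans ltr01 (eigval_gt1 pc).
have [st [d [d1 stc d0 dh dz]]] := supporting_form gM t (root_frame pc)
  lam0 (eigval'_gt0 pc) (eigval_prod pc) (eigconj_diag pc).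
have ch : farey_closed_tree farey_half by constructor.
have c0 : farey_closed_tree farey_zero by constructor.
have [lt0 lth] : (fnum farey_zero * fden c < fnum c * fden farey_zero
    /\ fnum c * fden farey_half < fnum farey_half * fden c)%N.
  by apply: farey_tree_between t.
(* The value -1 would put the fixed point of [c] above that of 0/1 and below that of 1/2, against
   [fixpt_half_lt_zero]. *)
have dE : d = 1.
  have : (d - 1) * (d + 1) = 0 by rewrite -subr_sqr expr1n d1 subrr.
  move/eqP; rewrite mulf_eq0 => /orP[|] /eqP e; first by lra.
  have {}e : d = -1 by lra.
  have [_ _ _ h0] := d0; have [_ _ _ hh] := dh.
  move: h0 hh; rewrite e opprK mul1r mulN1r oppr_ge0.
  rewrite (eigconj10_ge0 pc (node_positive c0)) (eigconj10_le0 pc (node_positive ch)).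
  by move=> h1 /(le_trans h1); rewrite leNgt fixpt_half_lt_zero.
have signed z : farey_closed_tree z ->
    ((fnum z * fden c <= fnum c * fden z)%N ->
      dominates (fun s => eigconj W (word_mx R s)) st (- d) z) /\
    ((fnum c * fden z <= fnum z * fden c)%N ->
      dominates (fun s => eigconj W (word_mx R s)) st d z).
  case=> [->|->|]; [| | exact: dz].
    by split=> // h; move: lt0; rewrite ltnNge h.
  by split=> // h; move: lth; rewrite ltnNge h.
split.
  exists st; split=> // z cz; have [h1 h2] := signed z cz.
  case: (leqP (fnum z * fden c) (fnum c * fden z)) => [/h1|/ltnW /h2];
    exact: dominates_le_eigval.
move=> z cz; have [h1 h2] := signed z cz; split=> [/h1|/h2] [_ _ _].
  by rewrite dE mulN1r oppr_ge0 (eigconj10_le0 pc (node_positive cz)).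
by rewrite dE mul1r (eigconj10_ge0 pc (node_positive cz)).
Qed.

Lemma fixpt_antitone x y : farey_closed_tree x -> farey_closed_tree y ->
  (fnum x * fden y <= fnum y * fden x)%N ->
  fixpt (node_mx y) <= fixpt (node_mx x).
Proof.
move=> cx cy le; case: (cx) => [ex|ex|tx]; last first.
- by have [_ /(_ y cy)[_]] := node_support tx; apply.
- case: (cy) => [ey|ey|ty]; last first.
  + by have [_ /(_ x cx)[+ _]] := node_support ty; apply.
  + by rewrite ex ey.
  + by move: le; rewrite ex ey.
- case: (cy) => [ey|ey|ty]; last first.
  + by have [_ /(_ x cx)[+ _]] := node_support ty; apply.
  + by rewrite ex ey ltW // fixpt_half_lt_zero.
  + by rewrite ex ey.
Qed.

(** Since 1/2 is an end of the tree and no mediant, domination at 0/1 in its eigenbasis is checked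
    by hand and then spreads over the tree. The form grows by [ln alpha] for each copy of 0/1 in
    [z], where equality would need only [ln kap]. *)
Lemma node_lyapunov_gt_half z : farey_closed_tree z -> z <> farey_half ->
  node_lyapunov farey_half < node_lyapunov z.
Proof.
move=> cz zh; pose W := node_mx farey_half.
have ch : farey_closed_tree farey_half by constructor.
have pW : positive_sl2 W := node_positive ch.
have gM s1 s2 : eigconj W (word_mx R (s1 ++ s2))
    = eigconj W (word_mx R s1) *m eigconj W (word_mx R s2).
  by rewrite word_mx_cat eigconjM.
have s2 : Num.sqrt 2 ^+ 2 = 2 :> R by rewrite sqr_sqrtr.
have /andP[s_lo s_hi] := sqrt2_bounds.
pose kap : R := 1 + Num.sqrt 2.
(* This is the upper left entry of the matrix of 0/1 in the eigenbasis at 1/2. *)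
pose alpha : R := 3 / 2 + 3 / 4 * Num.sqrt 2.
have a0 : 0 < alpha by rewrite /alpha; lra.
have k0 : 0 < kap by rewrite /kap; lra.
have nb : farey_neighbours farey_zero farey_half by [].
have [st [st0 sth]] := linear_form_interp (ln alpha) (ln (eigval W)) nb.
have lam0 : 0 < eigval W by apply: lt_trans ltr01 (eigval_gt1 pW).
have dh : dominates (fun s => eigconj W (word_mx R s)) st (-1) farey_half.
  rewrite /dominates eigconj_diag // !mxE /= sth expRN lnK ?posrE // !mulr0.
  split=> //; rewrite -[X in X <= _]mul1r ler_pdivrMr //.
  by rewrite mulrC eigval_prod.
have d0 : dominates (fun s => eigconj W (word_mx R s)) st (-1) farey_zero.
  rewrite /dominates st0 expRN lnK ?posrE //.
  have [-> -> -> ->] := eigconjE pW (word_mx R (fword farey_zero)).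
  rewrite -/(node_mx farey_zero) node_mx_zero fixpt_half fixpt'_half !mxE /=.
  have dd : 0 < Num.sqrt 2 - 1 - (- Num.sqrt 2 - 1) :> R by lra.
  split.
  - by rewrite ler_pdivlMr // /alpha; lra.
  - rewrite ler_pdivlMr // mulrC ler_pdivrMr // /alpha; nra.
  - by rewrite mulrA divr_ge0 //; lra.
  - by rewrite mulrA divr_ge0 //; lra.
have d1 : (-1) ^+ 2 = 1 :> R by rewrite sqrrN expr1n.
(* Only 1/2 itself has [i = 0]; a positive [i] makes the final inequality strict. *)
have [i [j [i0 enum eden]]] : exists i j, [/\ (0 < i)%N,
    fnum z = (i * fnum farey_zero + j * fnum farey_half)%N
    & fden z = (i * fden farey_zero + j * fden farey_half)%N].
  case: cz => [->|//|]; first by exists 1%N, 0%N.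
  by case/farey_tree_coord => i [j [? _ ? ?]]; exists i, j.
have dz : dominates (fun s => eigconj W (word_mx R s)) st (-1) z.
  by case: cz => [->|//|t] //; apply: (dominates_tree gM d1 t).
have low : i%:R * ln alpha + j%:R * ln (eigval W) <= ln (eigval (node_mx z)).
  apply: le_trans (dominates_le_eigval pW cz dz).
  rewrite -st0 -sth /linear_form enum eden !natrD !natrM; lra.
have lh : ln (eigval W) = 2 * ln kap.
  by rewrite eigval_half -/kap lnXn // mulr_natl.
have la : ln kap < ln alpha.
  by rewrite ltr_ln ?posrE // /kap /alpha; nra.
have [_ z0 _] := farey_closed_tree_facts cz.
rewrite /node_lyapunov -/W lh ltr_pdivlMr ?ltr0n ?muln_gt0 //.
apply: lt_le_trans low; rewrite lh eden /= !natrM natrD !natrM.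
have i1 : 0 < i%:R :> R by rewrite ltr0n.
have : i%:R * ln kap < i%:R * ln alpha by rewrite ltr_pM2l.
lra.
Qed.

End SpectralBound.

(** * Markov-Hurwitz numbers *)

Lemma convex_comb_between (K : realFieldType) (x y z : K) : x < y -> y < z ->
  exists t, [/\ 0 < t, t < 1 & y = t * x + (1 - t) * z].
Proof.
move=> xy yz; have xz : 0 < z - x by lra.
exists ((z - y) / (z - x)); split.
- by rewrite divr_gt0 //; lra.
- by rewrite ltr_pdivrMr //; lra.
- by field; rewrite gt_eqF.
Qed.

Section MarkovHurwitzLyapunov.
Variable R : realType.
Implicit Types (r s t u : rat).

Let F r : R := Lyapunov (markov_hurwitz R r).

Lemma markov_hurwitz_word r z : farey_closed_tree z -> farey_word r = fword z ->
  markov_hurwitz R r = fixpt (node_mx R z) /\ F r = node_lyapunov R z.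
Proof.
move=> cz wz; have [adm d0 sz] := farey_closed_tree_facts R cz.
have e : markov_hurwitz R r = fixpt (node_mx R z).
  by rewrite /markov_hurwitz wz cfrac_periodic_fixpt.
split=> //; rewrite /F e Lyapunov_periodic //; first by rewrite sz.
by rewrite sz muln_gt0.
Qed.

Lemma markov_hurwitz_zero :
  markov_hurwitz R 0 = fixpt (node_mx R farey_zero) /\
  F 0 = node_lyapunov R farey_zero.
Proof. by apply: (@markov_hurwitz_word 0 farey_zero _ farey_word0); constructor. Qed.

Lemma markov_hurwitz_half :
  markov_hurwitz R (1 / 2) = fixpt (node_mx R farey_half) /\
  F (1 / 2) = node_lyapunov R farey_half.
Proof. by apply: (@markov_hurwitz_word (1 / 2) farey_half _ farey_word_half); constructor. Qed.

Lemma markov_hurwitz_node r : farey_domain r -> exists z,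
  [/\ farey_closed_tree z, r = (fnum z)%:R / (fden z)%:R,
      markov_hurwitz R r = fixpt (node_mx R z) & F r = node_lyapunov R z].
Proof.
move=> /farey_closed_treeP[z [cz wz rz]]; exists z.
by have [] := markov_hurwitz_word cz wz.
Qed.

Lemma farey_node_le (x y : farey_node) :
  farey_closed_tree x -> farey_closed_tree y ->
  (((fnum x)%:R / (fden x)%:R : rat) <= (fnum y)%:R / (fden y)%:R)
  = (fnum x * fden y <= fnum y * fden x)%N.
Proof.
move=> /(farey_closed_tree_facts R)[_ x0 _] /(farey_closed_tree_facts R)[_ y0 _].
by rewrite ler_pdivrMr ?ltr0n // mulrAC ler_pdivlMr ?ltr0n // -!natrM ler_nat.
Qed.

Lemma markov_hurwitz_antitone r s : farey_domain r -> farey_domain s ->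
  r <= s -> markov_hurwitz R s <= markov_hurwitz R r.
Proof.
move=> /markov_hurwitz_node[x [cx -> -> _]] /markov_hurwitz_node[y [cy -> -> _]].
by rewrite farey_node_le //; apply: fixpt_antitone.
Qed.

(** Divided by 2q, the linear form of [node_support] becomes affine in p/q. *)
Lemma Lyapunov_support u : farey_domain u -> u != 0 -> u != 1 / 2 ->
  exists a b : R, F u = a * ratr u + b /\
    forall r, farey_domain r -> a * ratr r + b <= F r.
Proof.
move=> /markov_hurwitz_node[c [cc eu _ Fu]] u0 uh.
have tc : farey_tree farey_zero farey_half c.
  by case: cc => [ec|ec|//]; [move: u0 | move: uh]; rewrite eu ec ?mul0r eqxx.
have [[st [stc sup]] _] := node_support R tc.
have form z : farey_closed_tree z ->
    st.1 / 2 * ratr ((fnum z)%:R / (fden z)%:R) + st.2 / 2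
    = linear_form st z / (2 * fden z)%:R.
  move=> /(farey_closed_tree_facts R)[_ z0 _].
  rewrite /linear_form fmorph_div /= !ratr_nat natrM; field.
  by rewrite pnatr_eq0 -lt0n.
exists (st.1 / 2), (st.2 / 2); split.
  by rewrite Fu eu form // /node_lyapunov stc.
move=> r /markov_hurwitz_node[z [cz -> _ ->]]; rewrite form // /node_lyapunov.
have [_ z0 _] := farey_closed_tree_facts R cz.
by rewrite ler_pM2r ?invr_gt0 ?ltr0n ?muln_gt0 // sup.
Qed.

Lemma farey_domain_convex r s t : farey_domain r -> farey_domain s ->
  0 <= t <= 1 -> farey_domain (t * r + (1 - t) * s).
Proof.
move=> /andP[r0 r1] /andP[s0 s1] /andP[t0 t1] /=; apply/andP; split.
  by rewrite addr_ge0 // mulr_ge0 // subr_ge0.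
have -> : 1 / 2 = t * (1 / 2) + (1 - t) * (1 / 2) :> rat by ring.
by rewrite lerD // ler_wpM2l // subr_ge0.
Qed.

(** At an interior point [u], average the supporting line at [u] over [r] and [s]. The ends of the
    domain are extreme points, where the combination is trivial. *)
Lemma Lyapunov_convex r s t : farey_domain r -> farey_domain s ->
  0 <= t <= 1 ->
  F (t * r + (1 - t) * s) <= ratr t * F r + ratr (1 - t) * F s.
Proof.
move=> fr fs t01; have fu := farey_domain_convex fr fs t01.
set u := _ + _ in fu *; have /andP[t0 t1] := t01.
have endpoint : (t = 0 \/ r = u) -> (1 - t = 0 \/ s = u) ->
    F u <= ratr t * F r + ratr (1 - t) * F s.
  case=> [t00 _|<-].
    by rewrite /u t00 rmorph0 subr0 rmorph1 !mul0r !add0r !mul1r.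
  case=> [t11|->].
    have -> : t = 1 by lra.
    by rewrite subrr rmorph0 rmorph1 mul0r addr0 mul1r.
  by rewrite -mulrDl -rmorphD /= addrCA subrr addr0 rmorph1 mul1r.
(* If [r - a] and [s - a] have the same sign, their weighted sum vanishes only if each term does: a
   weight is 0 or a point equals [a]. *)
have {}endpoint a : u = a -> 0 <= (r - a) * (s - a) ->
    F u <= ratr t * F r + ratr (1 - t) * F s.
  move=> ua same; have sum0 : t * (r - a) + (1 - t) * (s - a) = 0.
    by rewrite -ua /u; ring.
  have prod0 : 0 <= t * (r - a) * ((1 - t) * (s - a)).
    by rewrite mulrACA mulr_ge0 // mulr_ge0 // subr_ge0.
  have QP : (1 - t) * (s - a) = - (t * (r - a)).
    by apply/eqP; rewrite -addr_eq0 addrC sum0.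
  have P0 : t * (r - a) = 0.
    apply/eqP; rewrite -sqrf_eq0 eq_le sqr_ge0 andbT expr2.
    by rewrite -oppr_ge0 -mulrN -QP.
  have Q0 : (1 - t) * (s - a) = 0 by rewrite QP P0 oppr0.
  apply: endpoint; [move/eqP: P0 | move/eqP: Q0];
    by rewrite mulf_eq0 => /orP[] /eqP h; [left | right; rewrite ua; lra].
have /andP[r0 r1] := fr; have /andP[s0 s1] := fs.
have [u0|u0] := eqVneq u 0.
  by apply: (endpoint _ u0); rewrite !subr0 mulr_ge0.
have [uh|uh] := eqVneq u (1 / 2).
  by apply: (endpoint _ uh); rewrite mulr_le0 // subr_le0.
have [a [b [-> sup]]] := Lyapunov_support fu u0 uh.
have -> : a * ratr u + b
  = ratr t * (a * ratr r + b) + ratr (1 - t) * (a * ratr s + b).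
  by rewrite /u rmorphD /= !rmorphM /= rmorphB /= rmorph1; ring.
by rewrite lerD // ler_wpM2l ?ler0q ?subr_ge0 // sup.
Qed.

Lemma farey_domain0 : farey_domain 0. Proof. by []. Qed.
Lemma farey_domain_half : farey_domain (1 / 2). Proof. by []. Qed.

Lemma Lyapunov_gt_half r : farey_domain r -> r < 1 / 2 -> F (1 / 2) < F r.
Proof.
move=> /markov_hurwitz_node[z [cz er _ ->]] rh.
have [_ ->] := markov_hurwitz_half.
apply: node_lyapunov_gt_half => // ez.
by move: rh; rewrite er ez ltxx.
Qed.

(** For [s] below 1/2, write [s] as a convex combination of [r] and 1/2 with positive weight at 1/2,
    where the value is strictly smaller than at [r]. *)
Lemma Lyapunov_antitone r s : farey_domain r -> farey_domain s -> r < s ->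
  F s < F r.
Proof.
move=> fr fs rs; have /andP[_ sh] := fs.
move: (sh); rewrite le_eqVlt => /orP[/eqP e|sh'].
  by rewrite e in rs *; apply: Lyapunov_gt_half.
have rh : r < 1 / 2 := lt_trans rs sh'.
have [t [t0 t1 ->]] := convex_comb_between rs sh'.
have t01 : 0 <= t <= 1 by rewrite (ltW t0) (ltW t1).
apply: le_lt_trans (Lyapunov_convex fr farey_domain_half t01) _.
have lt := Lyapunov_gt_half fr rh.
have p : 0 < ratr (1 - t) :> R by rewrite ltr0q subr_gt0.
have {2}-> : F r = ratr t * F r + ratr (1 - t) * F r.
  by rewrite -mulrDl -rmorphD /= addrCA subrr addr0 rmorph1 mul1r.
by rewrite ltrD2l ltr_pM2l.
Qed.

End MarkovHurwitzLyapunov.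

Theorem theorem2 (R : realType) :
  let X : set R := markov_hurwitz_set R in
  let x1 : R := markov_hurwitz R 0 in
  let x2 : R := markov_hurwitz R (1 / 2) in
  let F : rat -> R := fun r => Lyapunov (markov_hurwitz R r) in
  [/\ (forall x y : R, X x -> X y -> x < y -> Lyapunov x < Lyapunov y),
      [/\ x2 = Num.sqrt 2 - 1, X x2 & forall x : R, X x -> x2 <= x],
      [/\ x1 = (Num.sqrt 5 - 1) / 2, X x1 & forall x : R, X x -> x <= x1],
      Lyapunov x2 = 1 / 2 * ln (1 + Num.sqrt 2) /\
      Lyapunov x1 = ln ((1 + Num.sqrt 5) / 2) &
      forall (r s t : rat), farey_domain r -> farey_domain s -> 0 <= t <= 1 ->
        F (t * r + (1 - t) * s) <= ratr t * F r + ratr (1 - t) * F s].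
Proof.
move=> X x1 x2 F.
have [f0 fh] := (farey_domain0, farey_domain_half).
have [[e2 L2] [e1 L1]] := (markov_hurwitz_half R, markov_hurwitz_zero R).
split.
- move=> _ _ [r fr <-] [s fs <-] lt; apply: Lyapunov_antitone => //.
  (* Weak antitonicity of the parametrization suffices: [r <= s] would contradict the strict
     inequality [lt]. *)
  rewrite ltNge; apply/negP => /(markov_hurwitz_antitone R fr fs).
  by rewrite leNgt lt.
- split; [by rewrite /x2 e2 fixpt_half | by exists (1 / 2) |].
  by move=> _ [r fr <-]; apply: markov_hurwitz_antitone => //; case/andP: fr.
- split; [by rewrite /x1 e1 fixpt_zero | by exists 0 |].
  by move=> _ [r fr <-]; apply: markov_hurwitz_antitone => //; case/andP: fr.
- rewrite /x1 /x2 L1 L2; split; [exact: node_lyapunov_half | exact: node_lyapunov_zero].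
- by move=> r s t fr fs t01; apply: Lyapunov_convex.
Qed.
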